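(* The number $\Gamma_{i}^{\left[s\atop{s\atop s}\right]\times k}$ of rank $i$ triple persymmetric $3s\times k$ matrices over $\mathbb{F}_2$ is \begin{equation*} \begin{cases} 1 & \text{if } i=0,\\ 105\cdot 2^{4i-6} - 21\cdot 2^{3i-5} & \text{if } 1\leq i\leq s-1,\ k\geq i+1,\\ 7\cdot 2^{k+s-1} - 7\cdot 2^{2s} + 105\cdot 2^{4s-6} - 21\cdot 2^{3s-5} & \text{if } i=s,\ k\geq s+1,\ s\geq 1,\\ 147\cdot(5\cdot 2^{j-1}-1)\cdot 2^{k+s+3j-6} + 21\cdot\big[5\cdot 2^{4s+4j-6} - 2^{3s+3j-5} - (155\cdot 2^{j-1}-35)\cdot 2^{2s+4j-7}\big] & \text{if } i=s+j,\ 1\leq j\leq s-1,\ k\geq s+j+1,\\ 7\cdot 2^{2k+2s-2} + 21\cdot\big[35\cdot 2^{k+5s-7} - 39\cdot 2^{k+4s-6}\big] + 7\cdot\big[15\cdot 2^{8s-6} - 465\cdot 2^{7s-8} + 349\cdot 2^{6s-7}\big] & \text{if } i=2s,\ k\geq 2s+1,\\ 105\cdot\big(2^{2k+2s+4j-2} + 7\cdot 2^{k+5s+4j-3} - 31\cdot 2^{k+4s+5j-3}\big) + 105\cdot\big(2^{8s+4j-2} - 31\cdot 2^{7s+5j-3} + 93\cdot 2^{6s+6j-3}\big) & \text{if } i=2s+1+j,\ k\geq 2s+2+j,\ 0\leq j\leq s-2,\\ 2^{3k+3s-3} - 7\cdot 2^{2k+6s-6} + 7\cdot 2^{k+9s-8}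 - 2^{12s-9} & \text{if } i=3s,\ k\geq 3s. \end{cases} \end{equation*} Moreover \begin{equation*} \Gamma_{i}^{\left[s\atop{s\atop s}\right]\times i} = \begin{cases} 2^{3s+3i-3} - 7\cdot 2^{4i-6} + 3\cdot 2^{3i-5} & \text{if } 1\leq i\leq s+1,\\ 2^{6s+3j-3} + 7\cdot 2^{2s+5j-8} - 7\cdot 2^{2s+4j-7} - 7\cdot 2^{4s+4j-6} + 3\cdot 2^{3s+3j-5} & \text{if } i=s+j,\ 1\leq j\leq s+1,\\ 2^{9s+3j} - 7\cdot 2^{8s+4j-2} + 7\cdot 2^{7s+5j-3} - 2^{6s+6j-3} & \text{if } i=2s+1+j,\ 0\leq j\leq s-1. \end{cases} \end{equation*} For $0\leq j\leq s-2$, $k\geq 2s+2+j$: $\Gamma_{2s+1+j}^{\left[s\atop{s\atop s}\right]\times k} = 16^{3j}\cdot\Gamma_{2(s-j)+1}^{\left[s-j\atop{s-j\atop s-j}\right]\times(k-3j)}$. For $0\leq j\leq s-1$: $\Gamma_{2s+1+j}^{\left[s\atop{s\atop s}\right]\times(2s+1+j)} = 16^{3j}\cdot\Gamma_{2(s-j)+1}^{\left[s-j\atop{s-j\atop s-j}\right]\times(2(s-j)+1)}$. For $k\geq 3s$: $\Gamma_{3s}^{\left[s\atop{s\atop s}\right]\times k} = 16^{3(s-1)}\cdot\Gamma_{3}^{\left[1\atop{1\atop 1}\right]\times(k-3(s-1))}$.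
   Context: $\Gamma_{i}^{\left[a\atop{b\atop c}\right]\times k}$ denotes the number of rank $i$ matrices over $\mathbb{F}_2$ of the form $\left[\frac{A}{\frac{B}{C}}\right]$ where $A$, $B$, $C$ are persymmetric matrices over $\mathbb{F}_2$ of sizes $a\times k$, $b\times k$, $c\times k$ (a matrix $[\alpha_{i,j}]$ is persymmetric if $\alpha_{i,j}=\alpha_{r,s}$ whenever $i+j=r+s$). Here $a=b=c=s$. *)

(* Defs.v *)
From mathcomp Require Import all_boot all_order all_algebra.

Set Implicit Arguments.
Unset Strict Implicit.
Unset Printing Implicit Defensive.

Import Order.TTheory GRing.Theory Num.Theory.
Local Open Scope ring_scope.

Definition persymmetric (m n : nat) (A : 'M['F_2]_(m, n)) : bool :=
  [forall i : 'I_m, forall j : 'I_n, forall r : 'I_m, forall t : 'I_n,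
     (i + j == r + t)%N ==> (A i j == A r t)].

(* M is the block matrix with A on top of B on top of C. *)
Definition triple_persymmetric (a b c k : nat)
    (M : 'M['F_2]_(a + (b + c), k)) : bool :=
  [&& persymmetric (usubmx M),
      persymmetric (usubmx (dsubmx M))
    & persymmetric (dsubmx (dsubmx M))].

(* Rank index first: [Gamma i a b c k] has subscript i, block heights a, b, c
   and width k. *)
Definition Gamma (i a b c k : nat) : nat :=
  #|[set M : 'M['F_2]_(a + (b + c), k) |
      triple_persymmetric M && (\rank M == i)]|.

(* Main.v *)
Require Import Defs.
From mathcomp Require Import all_boot all_order all_algebra mxabelem.
From mathcomp Require Import zify ring.

(** A triple persymmetric [3s x k] matrix is a sequence [t] of [N = s + k - 1]
    vectors of F_q^n (here q = 2 and n = 3), and its rank is the dimension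
    spanned by the [k] windows of length [s] of [t].  Such a [t] is an extension
    of O(N + 1) by O^n on P^1, and the splitting type e_0 >= ... >= e_n of the
    middle bundle, whose sum is N + 1, gives all the window ranks: rank_s(t) + s
    is the sum of the min(e_j, s).  The shape of [t] is the conjugate partition.
    Prepending a vector to [t] adds one box to the shape, and the number of
    vectors adding a box to a given row depends only on the shape and on the row
    of the last box added.  This Markov chain has a product-form solution whose
    factors involve two consecutive rows, so prepending a row to a shape
    multiplies the number of sequences by a factor depending only on that row
    and the next.  Summing over shapes gives a recursion from windows of length
    [s] to windows of length [s + 1] between the numbers of [t] with given rank
    and given dimension of the span of the entries; the closed forms follow by
    induction on [s]. *)

Set Implicit Arguments.
Unset Strict Implicit.
Unset Printing Implicit Defensive.

Import Order.TTheory GRing.Theory Num.Theory.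
Local Open Scope ring_scope.

(** * Sums and cardinals *)

Lemma natr_card (R : pzSemiRingType) (T : finType) (P : pred T) :
  #|[set x | P x]|%:R = \sum_x (P x)%:R :> R.
Proof.
rewrite -sum1dep_card natr_sum big_mkcond.
by apply: eq_bigr => x _; case: (P x).
Qed.

Lemma card_tuple0 (T : finType) (P : pred (seq T)) :
  #|[set t : 0.-tuple T | P t]| = P [::].
Proof.
case P0: (P [::]).
  rewrite -[RHS](card_tuple 0 T) -cardsT.
  by apply: eq_card => t; rewrite !inE tuple0 P0.
by apply: eq_card0 => t; rewrite inE tuple0 P0.
Qed.

Lemma big_tuple_cons (R : nmodType) (T : finType) N (f : seq T -> R) :
  \sum_(t : N.+1.-tuple T) f t = \sum_(t : N.-tuple T) \sum_(x : T) f (x :: t).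
Proof.
pose cons_pair (u : N.-tuple T * T) := [tuple of u.2 :: u.1].
rewrite pair_big (reindex cons_pair) //=.
exists (fun t : N.+1.-tuple T => ([tuple of behead t], thead t)).
  by move=> [t x] _ /=; congr (_, _); apply: val_inj.
by move=> t _; rewrite /cons_pair /= -tuple_eta.
Qed.

Lemma eq_from_differences (V : zmodType) (f g : nat -> V) m :
    (forall i, f i - f i.+1 = g i - g i.+1) ->
    (forall i, (m <= i)%N -> f i = g i) ->
  f =1 g.
Proof.
move=> eq_diff eq_above i; move: {2}(m - i)%N (erefl (m - i)%N) => k.
elim: k i => [|k IHk] i def_k; first by apply: eq_above; lia.
by have := eq_diff i; rewrite (IHk i.+1); [apply: addIr | lia].
Qed.

Lemma natr_card_weighted_fibers (R : pzSemiRingType) (A B : finType)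
    (L : eqType) (f : A -> L) (g : B -> L) (P : pred L) (c : L -> R) :
    (forall l, P l ->
      #|[set a | f a == l]|%:R = c l * #|[set b | g b == l]|%:R) ->
  #|[set a | P (f a)]|%:R = \sum_b c (g b) * (P (g b))%:R.
Proof.
move=> card_fib; pose S := undup (codom f ++ codom g).
have sum_fibers (X : finType) (h : X -> L) (F : L -> R) :
    {subset codom h <= S} ->
    \sum_x F (h x) = \sum_(l <- S) F l * #|[set x | h x == l]|%:R.
  move=> sub_S; under [RHS]eq_bigr do rewrite natr_card mulr_sumr.
  rewrite exchange_big; apply: eq_bigr => x _ /=.
  rewrite (bigD1_seq (h x)) ?undup_uniq ?sub_S ?codom_f //= eqxx mulr1.
  by rewrite big1 ?addr0 // => l /negPf neq_l; rewrite eq_sym neq_l mulr0.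
rewrite natr_card (sum_fibers _ _ (fun l => (P l)%:R)); last first.
  by move=> l; rewrite mem_undup mem_cat => ->.
rewrite (sum_fibers _ _ (fun l => c l * (P l)%:R)); last first.
  by move=> l; rewrite mem_undup mem_cat orbC => ->.
apply: eq_bigr => l _; case: (boolP (P l)) => [/card_fib -> | _].
  by rewrite mul1r mulr1.
by rewrite mulr0 !mul0r.
Qed.

(** * Partitions *)

(* The polynomial \sum_j p_j 'X^j encodes the sequence p_0, p_1, ...; the
   number p.[1] is the sum of the parts. *)
Definition part (p : {poly nat}) j : nat := (p`_j)%R.

Definition is_partition (p : {poly nat}) : Prop :=
  forall j, (part p j.+1 <= part p j)%N.

Section Partitions.
Implicit Types p : {poly nat}.

Lemma part_addXn p i j : part (p + 'X^i) j = (part p j + (j == i))%N.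
Proof. by rewrite /part coefD coefXn natn. Qed.

Lemma part_cons x p j :
  part (cons_poly x p) j = if j is j'.+1 then part p j' else x.
Proof. by rewrite /part coef_cons; case: j. Qed.

Lemma part1 j : part 1 j = (j == 0%N).
Proof. by rewrite /part coef1; case: eqP. Qed.

Lemma cons_poly_addXn x p r :
  cons_poly x (p + 'X^r) = cons_poly x p + 'X^(r.+1).
Proof. by rewrite !cons_poly_def mulrDl -exprSr addrAC. Qed.

Lemma is_partition_addXn p r :
  is_partition p -> (part p r.+1 < part p r)%N -> is_partition (p + 'X^(r.+1)).
Proof.
move=> p_dec addable j; rewrite !part_addXn eqSS; have := p_dec j.
by case: (eqVneq j r) addable => [<- | _]; lia.
Qed.

Lemma is_partition_cons x p :
  is_partition (cons_poly x p) <-> (part p 0 <= x)%N /\ is_partition p.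
Proof.
split=> [p_dec | [p0_le p_dec]].
  by split=> [|j]; [have := p_dec 0%N | have := p_dec j.+1]; rewrite !part_cons.
by case=> [|j]; rewrite !part_cons.
Qed.

Lemma addp_nat_inj p : injective (fun p' => p' + p).
Proof.
move=> p1 p2 /polyP eq_p; apply/polyP => j; have := eq_p j.
by rewrite !coefD => /addIn.
Qed.

Lemma poly_is_cons p : exists x p', p = cons_poly x p'.
Proof.
exists (part p 0), (drop_poly 1 p); apply/polyP => j.
by rewrite coef_cons coef_drop_poly; case: j => [|j] //=; rewrite addn1.
Qed.

Lemma cons_poly_add1 x p : cons_poly x p + 1 = cons_poly x.+1 p.
Proof.
rewrite !cons_poly_def -addrA -polyC1 -polyCD.
by congr (_ + _%:P); apply: addn1.
Qed.

Lemma horner1_addXn p r : (p + 'X^r).[1] = p.[1].+1.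
Proof. by rewrite hornerD hornerXn expr1n; apply: addn1. Qed.

Lemma horner1_cons x p :
  (cons_poly x p).[1] = (p.[1] + x)%N.
Proof. by rewrite horner_cons mulr1. Qed.

Lemma cons_poly_inj x : injective (@cons_poly nat x).
Proof.
move=> p p' eq_cons; apply/polyP => j.
by have := congr1 (fun r => part r j.+1) eq_cons; rewrite !part_cons.
Qed.

Lemma horner1_sum_part p m :
  (size p <= m)%N -> p.[1] = (\sum_(i < m) part p i)%N.
Proof.
move=> le_m; rewrite (horner_coef_wide _ le_m).
by apply: eq_bigr => i _; rewrite expr1n mulr1.
Qed.

Lemma is_partition_leq p i j :
  is_partition p -> (i <= j)%N -> (part p j <= part p i)%N.
Proof.
move=> p_dec /subnK <-; elim: (j - i)%N => // k; exact: leq_trans (p_dec _).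
Qed.

Lemma part_oversize p j :
  is_partition p -> (p.[1] <= j)%N -> part p j = 0%N.
Proof.
move=> p_dec; apply: contraTeq; rewrite -lt0n -ltnNge => pj_gt0.
rewrite (@horner1_sum_part _ (j.+1 + size p)) ?leq_addl // big_split_ord /=.
apply: leq_trans (leq_addr _ _).
have : (\sum_(i < j.+1) 1 <= \sum_(i < j.+1) part p i)%N.
  apply: leq_sum => i _; apply: leq_trans pj_gt0 _.
  by rewrite is_partition_leq // -ltnS.
by rewrite sum1_card card_ord.
Qed.

Lemma part0_gt0 p :
  is_partition p -> (0 < p.[1])%N -> (0 < part p 0)%N.
Proof.
move=> p_dec; apply: contraTT; rewrite -!eqn0Ngt (horner1_sum_part (leqnn _)).
rewrite sum_nat_eq0 => /eqP p0; apply/forallP => i; apply/implyP => _.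
by rewrite -leqn0 -p0 is_partition_leq.
Qed.

Lemma sum_part_eq_horner1 p s :
  is_partition p -> part p s = 0%N -> (\sum_(j < s) part p j)%N = p.[1].
Proof.
move=> p_dec ps0; rewrite (@horner1_sum_part _ (s + size p)) ?leq_addl //.
rewrite big_split_ord /= [X in (_ + X)%N]big1 ?addn0 // => j _.
by apply/eqP; rewrite -leqn0 -ps0 is_partition_leq // leq_addr.
Qed.

Lemma partition_horner1_eq1 p : is_partition p -> p.[1] = 1 -> p = 1.
Proof.
move=> p_dec p1.
have part_S j : part p j.+1 = 0%N by rewrite part_oversize ?p1.
have def_p : p = (part p 0)%:P.
  by apply/polyP => -[|j]; rewrite coefC //; apply: part_S.
by rewrite def_p hornerC in p1 *; rewrite p1.
Qed.

Lemma remove_corner x p r :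
  is_partition (cons_poly x p) -> (part p r.+1 < part p r)%N ->
  exists p', [/\ is_partition (cons_poly x p'),
    (part p' r < part (cons_poly x p') r)%N & p = p' + 'X^r].
Proof.
move=> xp_dec corner; pose p' := \poly_(i < size p) (part p i - (i == r))%N.
have part_p' j : part p' j = (part p j - (j == r))%N.
  rewrite {1}/part coef_poly; case: ltnP => // le_j.
  by rewrite /part nth_default.
have [p0_le p_dec] := (is_partition_cons _ _).1 xp_dec.
exists p'; split.
- apply/is_partition_cons; split=> [|j]; first by rewrite part_p'; lia.
  have := p_dec j; rewrite !part_p'.
  by case: (eqVneq j r) corner => [-> | _]; lia.
- have -> : part (cons_poly x p') r = part (cons_poly x p) r.
    rewrite !part_cons; case: (r) part_p' => // j part_p'.
    by rewrite part_p' ltn_eqF // subn0.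
  by have := xp_dec r; rewrite part_cons part_p' eqxx; lia.
- apply/polyP => j; rewrite -!/(part _ j) part_addXn part_p' subnK //.
  by case: eqP => // ->; apply: leq_trans corner.
Qed.

End Partitions.

(** * Weights of partitions *)

Section PartitionWeight.
Variables (R : fieldType) (q : R) (n : nat).
Hypothesis q_pow_neq1 : forall m, q ^+ m.+1 != 1.
Hypothesis q_neq0 : q != 0.
Implicit Types p : {poly nat}.

(* If p is the conjugate of a splitting type then [part p j - part p j.+1] is
   the multiplicity m of j + 1 in that type, and the product below is the order
   of GL_m(F_q) up to a power of q. *)
Definition step_weight x y : R :=
  q ^+ (x * x.-1) / \prod_(i < x - y) (q ^+ i.+1 - 1).

Definition head_weight x : R :=
  q * \prod_(i < x.-1) ((1 - q ^- i.+1) * (q ^+ (n - i) - 1)).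

Definition chain_weight p : R :=
  \prod_(i < size p) step_weight (part p i) (part p i.+1).

Definition weight p : R := head_weight (part p 0) * chain_weight p.

Lemma expr_pred_sub1 x : q ^+ x.-1 * (1 - q ^- x) = (q ^+ x - 1) / q.
Proof.
case: x => [|x]; first by rewrite expr0 invr1 !subrr mulr0 mul0r.
by rewrite exprS; field; rewrite q_neq0 expf_neq0.
Qed.

Lemma prod_pow_sub1_neq0 m : \prod_(i < m) (q ^+ i.+1 - 1) != 0.
Proof. by apply/prodf_neq0 => i _; rewrite subr_eq0. Qed.

Lemma step_weightSl x y : (y <= x)%N ->
  step_weight x.+1 y * (q ^- y - q ^- x.+1) = step_weight x y * (q ^+ x / q).
Proof.
move=> le_yx; rewrite /step_weight subSn // big_ord_recr /=.
have -> : q ^- y - q ^- x.+1 = (q ^+ (x - y).+1 - 1) / q ^+ x.+1.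
  rewrite mulrBl -subSn // exprB ?unitfE ?leqW // mul1r mulrAC.
  by rewrite divff ?expf_neq0 // mul1r.
have -> : (x.+1 * x = x * x.-1 + x + x)%N by case: x {le_yx} => // x; lia.
rewrite !exprD !exprS; field.
by rewrite q_neq0 prod_pow_sub1_neq0 expf_neq0 //= -exprS subr_eq0.
Qed.

Lemma step_weightSr x y : (y < x)%N ->
  step_weight x y.+1 * q ^+ y = step_weight x y * (q ^+ x - q ^+ y).
Proof.
move=> lt_yx; rewrite /step_weight -(subnSK lt_yx) big_ord_recr /= subnSK //.
have -> : q ^+ x = q ^+ (x - y) * q ^+ y by rewrite -exprD subnK // ltnW.
rewrite -(subnSK lt_yx) exprS; field.
by rewrite prod_pow_sub1_neq0 -exprS subr_eq0 q_pow_neq1.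
Qed.

Lemma chain_weight_wide m p : (size p <= m)%N ->
  chain_weight p = \prod_(i < m) step_weight (part p i) (part p i.+1).
Proof.
move=> le_m; rewrite -(subnKC le_m) big_split_ord /=.
rewrite [X in _ * X]big1 ?mulr1 // => i _.
rewrite /part !nth_default ?leqW ?leq_addr // /step_weight.
by rewrite big_ord0 expr0 divr1.
Qed.

Lemma chain_weight_cons x p :
  chain_weight (cons_poly x p) = step_weight x (part p 0) * chain_weight p.
Proof.
rewrite (@chain_weight_wide (size p).+1); last first.
  by rewrite size_cons_poly; case: ifP.
rewrite big_ord_recl !part_cons; congr (_ * _).
by apply: eq_bigr => i _; rewrite lift0 !part_cons.
Qed.

Lemma chain_weight_add1 p : (part p 1 <= part p 0)%N ->
  chain_weight (p + 1) * (q ^- part p 1 - q ^- (part p 0).+1)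
  = chain_weight p * (q ^+ part p 0 / q).
Proof.
have [x [p' ->]] := poly_is_cons p.
rewrite cons_poly_add1 !part_cons !chain_weight_cons => le_p'x.
by rewrite mulrAC step_weightSl // mulrAC.
Qed.

Lemma chain_weight_addXS p r :
    (part p r.+2 <= part p r.+1)%N -> (part p r.+1 < part p r)%N ->
  chain_weight (p + 'X^(r.+1)) * (q ^- part p r.+2 - q ^- (part p r.+1).+1)
  = chain_weight p * ((q ^+ part p r - q ^+ part p r.+1) / q).
Proof.
elim: r p => [|r IHr] p; have [x [p' ->]] := poly_is_cons p.
all: rewrite -cons_poly_addXn !part_cons !chain_weight_cons part_addXn.
all: move=> le_p' lt_p'.
  rewrite expr0 -mulrA chain_weight_add1 // addn1.
  by rewrite mulrCA (mulrA (step_weight _ _)) step_weightSr //; ring.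
by rewrite addn0 -mulrA IHr // mulrA.
Qed.

Lemma head_weightS x : (0 < x <= n)%N ->
  head_weight x.+1 = head_weight x * ((1 - q ^- x) * (q ^+ (n.+1 - x) - 1)).
Proof.
case: x => [|x] // /andP [_ le_xn].
by rewrite /head_weight /= big_ord_recr mulrA.
Qed.

Lemma head_weight_neq0 x : (x <= n.+1)%N -> head_weight x != 0.
Proof.
move=> le_x; rewrite mulf_neq0 //; apply/prodf_neq0 => i _.
have -> : (n - i = (n - i).-1.+1)%N by have := ltn_ord i; lia.
by rewrite mulf_neq0 // subr_eq0 // eq_sym invr_eq1.
Qed.

Lemma weight_addXn p r : is_partition p -> (0 < part p 0 <= n.+1)%N ->
    (part p r < part (cons_poly n.+1 p) r)%N ->
  weight (p + 'X^r) * (q ^- part p r.+1 - q ^- (part p r).+1)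
  = weight p * ((q ^+ part (cons_poly n.+1 p) r * (1 - q ^- part p r.-1)
                 - (q ^+ part p r - 1)) / q).
Proof.
move=> p_dec p0_bound; rewrite part_cons /weight part_addXn.
case: r => [|r] addable /=; last first.
  rewrite addn0 -!mulrA chain_weight_addXS //; do 2!congr (_ * _).
  by rewrite mulrBr mulr1 divff ?expf_neq0 //; ring.
have /andP [p0_gt0 _] := p0_bound.
rewrite addn1 head_weightS ?p0_gt0 // expr0 -2!mulrA (mulrA _ (chain_weight _)).
rewrite -(mulrA _ (chain_weight _)) chain_weight_add1 //.
have -> : q ^+ n.+1 = q ^+ (n.+1 - part p 0) * q ^+ part p 0.
  by rewrite -exprD subnK // ltnW.
by field; rewrite q_neq0 expf_neq0.
Qed.

End PartitionWeight.

(** * Ranks *)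

Section MatrixRank.
Variable F : fieldType.

Lemma mxrank_col_rV m n (u : 'rV[F]_n) (A : 'M[F]_(m, n)) :
  \rank (col_mx u A) = (\rank A + ~~ (u <= A)%MS)%N.
Proof.
rewrite -addsmxE; case: (boolP (u <= A)%MS) => [uA | uNA].
  by rewrite (addsmx_idPr uA) addn0.
rewrite mxrank_disjoint_sum ?rank_rV.
  by rewrite addnC (contraNneq _ uNA) // => ->; apply: sub0mx.
apply/eqP; rewrite -mxrank_eq0 -leqn0 -ltnS.
apply: leq_trans (rank_leq_row u); rewrite ltn_neqAle mxrankS ?capmxSl // andbT.
apply: contra uNA => /eqP rank_cap; apply: submx_trans (capmxSr u A).
by rewrite -(mxrank_leqif_sup (capmxSl u A)) rank_cap.
Qed.

Lemma mxrank_kermx_mul k m n (A : 'M[F]_(k, m)) (B : 'M[F]_(k, n)) :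
  \rank (kermx B *m A) = (\rank (row_mx A B) - \rank B)%N.
Proof.
have kerAB : (kermx B :&: kermx A :=: kermx (row_mx A B))%MS.
  apply/eqmxP/andP; split.
    apply/sub_kermxP; rewrite mul_mx_row.
    by rewrite (sub_kermxP (capmxSl _ _)) (sub_kermxP (capmxSr _ _)) row_mx0.
  have := mulmx_ker (row_mx A B); rewrite mul_mx_row -[0]row_mx0.
  by case/eq_row_mx => kerA kerB; rewrite sub_capmx !sub_kermx kerA kerB !eqxx.
have := mxrank_mul_ker (kermx B) A; rewrite kerAB !mxrank_ker.
by have := rank_leq_row (row_mx A B); have := rank_leq_row B; lia.
Qed.

Lemma eq_left_kernel_mxrank k m n (A : 'M[F]_(k, m)) (B : 'M[F]_(k, n)) :
  (forall z : 'rV_k, z *m A = 0 <-> z *m B = 0) -> \rank A = \rank B.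
Proof.
move=> eq_ker; have : \rank (kermx A) = \rank (kermx B).
  apply: eqmx_rank; apply/andP; split; apply/rV_subP => z /sub_kermxP z0.
    by apply/sub_kermxP/eq_ker.
  by apply/sub_kermxP/eq_ker.
by rewrite !mxrank_ker; have := rank_leq_row A; have := rank_leq_row B; lia.
Qed.

End MatrixRank.

Lemma card_row_mx_completions (F : finFieldType) k m n
    (b : 'rV[F]_n) (A : 'M[F]_(k, m)) (B : 'M[F]_(k, n)) : (b <= B)%MS ->
  #|[set v : 'rV_m | (row_mx v b <= row_mx A B)%MS]|
  = (#|F| ^ (\rank (row_mx A B) - \rank B))%N.
Proof.
case/submxP => z0 ->; rewrite -mxrank_kermx_mul -card_rowg.
rewrite -[RHS](card_imset _ (@addIr _ (z0 *m A))); apply: eq_card => v.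
rewrite inE; apply/submxP/imsetP => [[z] | [w]].
  rewrite mul_mx_row => /eq_row_mx [-> zB].
  exists ((z - z0) *m A); last by rewrite mulmxBl subrK.
  by rewrite mem_rowg submxMr //; apply/sub_kermxP; rewrite mulmxBl zB subrr.
rewrite mem_rowg => /submxP [y ->] ->; exists (y *m kermx B + z0).
rewrite mul_mx_row !mulmxDl -(mulmxA y _ A) -(mulmxA y _ B).
by rewrite mulmx_ker mulmx0 add0r.
Qed.

(** * Windows of a sequence of vectors *)

Section Windows.
Variables (F : finFieldType) (n : nat).
Implicit Types (t : seq 'rV[F]_n) (v : 'rV[F]_n).

(* Row j is the concatenation of the entries j, ..., j + s - 1 of t. *)
Fixpoint windows t k s : 'M[F]_(k, s * n) :=
  if s is s'.+1 return 'M[F]_(k, s * n) then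
    row_mx (\matrix_(j < k) nth 0 t j) (windows (behead t) k s')
  else 0.

Definition wrank s t : nat := \rank (windows t (size t + 1 - s) s).

Definition first_window_dep s t : bool :=
  (s <= size t)%N && (windows t 1 s <= windows (behead t) (size t - s) s)%MS.

Lemma row_windows t k s (j : 'I_k) :
  row j (windows t k s) = windows (drop j t) 1 s.
Proof.
elim: s t => [|s IHs] t /=; first by apply/matrixP => i [].
rewrite row_row_mx IHs rowK -!drop1 !drop_drop (addnC j 1); congr row_mx.
by apply/rowP => x; rewrite !mxE nth_drop addn0.
Qed.

Lemma windows_behead t k s :
  windows t (1 + k) s = col_mx (windows t 1 s) (windows (behead t) k s).
Proof.
apply/row_matrixP => j; case: (split_ordP j) => i ->.
  by rewrite rowKu !row_windows (ord1 i).
by rewrite rowKd !row_windows -drop1 drop_drop addn1.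
Qed.

Lemma windows_subS t k k' s :
  (k <= k')%N -> (windows t k s <= windows t k' s)%MS.
Proof.
move=> le_kk'; apply/row_subP => j; rewrite row_windows.
by have := row_sub (widen_ord le_kk' j) (windows t k' s); rewrite row_windows.
Qed.

Lemma windows_widthS s : exists P : 'M[F]_(s.+1 * n, s * n),
  forall t k, windows t k s = windows t k s.+1 *m P.
Proof.
elim: s => [|s [P windowsP]]; first by exists 0 => t k; apply/matrixP => i [].
exists (block_mx 1%:M 0 0 P) => t k /=.
rewrite (mul_row_block (\matrix_(j < k) nth 0 t j) (windows (behead t) k s.+1)).
by rewrite mulmx1 !mulmx0 addr0 add0r -windowsP.
Qed.

Lemma first_window_dep0 t : first_window_dep 0 t.
Proof. by apply/submxP; exists 0; apply/matrixP => i []. Qed.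

Lemma first_window_dep_leq s s' t :
  (s <= s')%N -> first_window_dep s' t -> first_window_dep s t.
Proof.
move=> /subnK <-; elim: (s' - s)%N => //= r IHr dep_r; apply: IHr.
move: dep_r; rewrite addSn /first_window_dep => /andP [lt_s dep].
have [P windowsP] := windows_widthS (r + s); rewrite ltnW //= windowsP.
apply: submx_trans (submxMr P dep) _; rewrite -windowsP.
by apply: windows_subS; lia.
Qed.

Lemma wrank_cons s v t : (s <= (size t).+1)%N ->
  wrank s (v :: t) = (wrank s t + ~~ first_window_dep s (v :: t))%N.
Proof.
move=> le_s; rewrite /wrank /first_window_dep /= le_s !addn1 /= -mxrank_col_rV.
rewrite -windows_behead.
by have -> : ((size t).+2 - s = 1 + ((size t).+1 - s))%N by lia.
Qed.

Lemma wrank0 t : wrank 0 t = 0%N.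
Proof. by apply/eqP; rewrite -leqn0; apply: rank_leq_col. Qed.

Lemma wrank_oversize s t : (size t < s)%N -> wrank s t = 0%N.
Proof.
move=> lt_s; apply/eqP; rewrite -leqn0.
by apply: leq_trans (rank_leq_row _) _; lia.
Qed.

Lemma card_first_window_dep s t : first_window_dep s t ->
  #|[set v | first_window_dep s.+1 (v :: t)]|
  = (#|F| ^ (wrank s.+1 t - wrank s t))%N.
Proof.
move=> dep_t; have /andP [le_s sub_t] := dep_t.
rewrite {1}/wrank (_ : size t + 1 - s.+1 = size t - s)%N; last lia.
have -> : wrank s t = \rank (windows (behead t) (size t - s) s).
  rewrite /wrank (_ : size t + 1 - s = 1 + (size t - s))%N; last lia.
  by rewrite windows_behead mxrank_col_rV sub_t addn0.
rewrite -(card_row_mx_completions (\matrix_(j < _) nth 0 t j) sub_t).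
apply: eq_card => v; rewrite !inE /first_window_dep ltnS le_s subSS /=.
by congr (row_mx _ _ <= _)%MS; apply/rowP => x; rewrite mxE.
Qed.

Lemma first_window_dep_behead s v t :
  first_window_dep s.+1 (v :: t) -> first_window_dep s t.
Proof.
rewrite /first_window_dep ltnS subSS => /andP [-> /submxP [z] /=].
by rewrite (mul_mx_row z) => /eq_row_mx [_ ->]; apply: submxMl.
Qed.

(** * The shape of a sequence *)

Definition dep_length t : nat :=
  \max_(s < (size t).+1 | first_window_dep s t) s.

Lemma first_window_depE s t : first_window_dep s t = (s <= dep_length t)%N.
Proof.
apply/idP/idP => [dep_s | le_s].
  have lt_s : (s < (size t).+1)%N by case/andP: dep_s.
  exact: (leq_bigmax_cond (Ordinal lt_s)).
have [|r dep_r max_r] := @eq_bigmax_cond _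
    [pred s : 'I_(size t).+1 | first_window_dep s t] (@nat_of_ord _).
  by apply/card_gt0P; exists ord0; apply: first_window_dep0.
by apply: first_window_dep_leq dep_r; rewrite -max_r.
Qed.

Lemma dep_length_leq_size t : (dep_length t <= size t)%N.
Proof. by apply/bigmax_leqP => s _; rewrite -ltnS. Qed.

Lemma dep_length_nil : dep_length [::] = 0%N.
Proof. by apply/eqP; rewrite -leqn0 dep_length_leq_size. Qed.

Lemma dep_length_cons v t : (dep_length (v :: t) <= (dep_length t).+1)%N.
Proof.
case def_s: (dep_length _) => [|s] //.
rewrite ltnS -first_window_depE; apply: (@first_window_dep_behead _ v).
by rewrite first_window_depE def_s.
Qed.

(* The conjugate of the splitting type: the coefficient of 'X^j is the number
   of parts greater than j. *)
Fixpoint shape t : {poly nat} :=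
  (if t is _ :: t' then shape t' else 0) + 'X^(dep_length t).

Lemma part_shape_cons v t j :
  part (shape (v :: t)) j
  = (part (shape t) j + (j == dep_length (v :: t)))%N.
Proof. exact: part_addXn. Qed.

Lemma shape_nil : shape [::] = 1.
Proof. by rewrite /= dep_length_nil add0r expr0. Qed.

Lemma horner1_shape t : (shape t).[1] = (size t).+1.
Proof.
by elim: t => [|v t IHt] /=; rewrite horner1_addXn ?IHt ?horner0.
Qed.

Lemma part_shape_oversize t j : (size t < j)%N -> part (shape t) j = 0%N.
Proof.
elim: t => [|v t IHt] lt_j; first by rewrite shape_nil part1; case: j lt_j.
have lt_dep := leq_ltn_trans (dep_length_leq_size (v :: t)) lt_j.
by rewrite part_shape_cons (IHt (ltnW lt_j)) (gtn_eqF lt_dep).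
Qed.

Lemma wrank_shape s t : (s <= (size t).+1)%N ->
  (wrank s t + s = \sum_(j < s) part (shape t) j)%N.
Proof.
elim: t s => [|v t IHt] s.
  case: s => [|[|//]] _; first by rewrite wrank0 big_ord0.
  by rewrite wrank_oversize // big_ord1 shape_nil part1.
have sum_shape r : (\sum_(j < r) part (shape (v :: t)) j
    = \sum_(j < r) part (shape t) j + (dep_length (v :: t) < r))%N.
  under eq_bigr do rewrite part_shape_cons.
  rewrite big_split /=; congr addn; case: ltnP => lt_r.
    rewrite (bigD1 (Ordinal lt_r)) //= eqxx big1 // => i /negPf neq_i.
    by apply/eqP; rewrite eqb0 -(inj_eq val_inj) /= in neq_i *; rewrite neq_i.
  by rewrite big1 // => i _; rewrite ltn_eqF // (leq_trans (ltn_ord i)).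
rewrite leq_eqVlt sum_shape => /predU1P [-> | le_s].
  rewrite wrank_oversize // big_ord_recr /= part_shape_oversize // addn0.
  have := dep_length_leq_size (v :: t); rewrite /= -ltnS => ->.
  by rewrite -IHt // wrank_oversize // !add0n addn1.
by rewrite wrank_cons // first_window_depE -ltnNge -IHt // addnAC.
Qed.

Lemma card_dep_length_geq s t :
  #|[set v | (s <= dep_length (v :: t))%N]|
  = (if s <= (dep_length t).+1
     then #|F| ^ (part (cons_poly n.+1 (shape t)) s).-1 else 0)%N.
Proof.
rewrite part_cons; case: s => [|s] /=; first by rewrite cardsT card_mx mul1n.
rewrite ltnS; case: leqP => [le_s | lt_s].
  have le_s_size := leq_trans le_s (dep_length_leq_size t).
  transitivity #|[set v | first_window_dep s.+1 (v :: t)]|.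
    by apply: eq_card => v; rewrite !inE first_window_depE.
  rewrite card_first_window_dep ?first_window_depE //; congr (_ ^ _)%N.
  have := wrank_shape (leqW le_s_size); have := @wrank_shape s.+1 t le_s_size.
  rewrite big_ord_recr /=; lia.
apply: eq_card0 => v; rewrite inE leqNgt ltnS.
by rewrite (leq_trans (dep_length_cons v t)).
Qed.

Lemma dep_length_corner v t :
  (part (shape t) (dep_length t).+1 < part (shape t) (dep_length t))%N ->
  (part (shape t) (dep_length (v :: t))
   < part (cons_poly n.+1 (shape t)) (dep_length (v :: t)))%N.
Proof.
move=> corner_t; set r := dep_length _.
have := dep_length_cons v t; rewrite -/r leq_eqVlt => /predU1P [-> | le_r].
  by rewrite part_cons.
have: ([set u | r.+1 <= dep_length (u :: t)]
    \proper [set u | r <= dep_length (u :: t)])%N.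
  apply/properP; split; first by apply/subsetP => u; rewrite !inE; apply: ltnW.
  by exists v; rewrite inE // ltnn.
move/proper_card; rewrite !card_dep_length_geq le_r (ltnW le_r).
rewrite ltn_exp2l ?card_finNzRing_gt1 //.
by rewrite part_cons /=; lia.
Qed.

Lemma shape_partition t :
  is_partition (cons_poly n.+1 (shape t))
  /\ (part (shape t) (dep_length t).+1 < part (shape t) (dep_length t))%N.
Proof.
elim: t => [|v t [part_t corner_t]].
  rewrite shape_nil dep_length_nil; split; last by rewrite !part1.
  by case=> [|j]; rewrite !part_cons !part1.
have corner_v := dep_length_corner v corner_t.
split; last first.
  have := part_t (dep_length (v :: t)).+1.
  by rewrite !part_cons !part_shape_cons eqxx eqn_leq ltnn; lia.
rewrite [shape _]/= cons_poly_addXn; apply: is_partition_addXn => //.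
by rewrite part_cons.
Qed.

(** * The number of sequences of given shape *)

Let q : rat := #|F|%:R.

Definition shape_count N p s : nat :=
  #|[set t : N.-tuple 'rV[F]_n | (shape t == p) && (s <= dep_length t)%N]|.

Lemma card_dep_length r t :
  #|[set v | dep_length (v :: t) == r]|%:R
  = (r.-1 <= dep_length t)%N%:R * q ^+ (part (cons_poly n.+1 (shape t)) r).-1
    - (r <= dep_length t)%N%:R * q ^+ (part (shape t) r).-1 :> rat.
Proof.
transitivity (#|[set v | (r <= dep_length (v :: t))%N]|%:R
              - #|[set v | (r < dep_length (v :: t))%N]|%:R : rat).
  rewrite !natr_card -sumrB; apply: eq_bigr => v _.
  by case: ltngtP; rewrite ?subrr ?subr0.
rewrite !card_dep_length_geq ltnS (part_cons _ _ r.+1).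
have -> : (r <= (dep_length t).+1)%N = (r.-1 <= dep_length t)%N by lia.
by congr (_ - _); case: ifP => _; rewrite ?natrX ?mul1r ?mul0r.
Qed.

Lemma shape_countS N p r :
  (shape_count N.+1 (p + 'X^r) r)%:R - (shape_count N.+1 (p + 'X^r) r.+1)%:R
  = (shape_count N p r.-1)%:R * q ^+ (part (cons_poly n.+1 p) r).-1
    - (shape_count N p r)%:R * q ^+ (part p r).-1 :> rat.
Proof.
rewrite /shape_count !natr_card -sumrB !mulr_suml -sumrB.
pose last_box (t : seq 'rV[F]_n) :=
  (shape t == p + 'X^r) && (dep_length t == r).
transitivity (\sum_(t : N.+1.-tuple 'rV[F]_n) (last_box t)%:R : rat).
  apply: eq_bigr => t _; rewrite /last_box.
  by case: (_ == _); case: ltngtP; rewrite ?subrr ?subr0.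
rewrite (big_tuple_cons _ (fun t => (last_box t)%:R)); apply: eq_bigr => t _.
have last_boxE v :
    last_box (v :: t) = (shape t == p) && (dep_length (v :: t) == r).
  rewrite /last_box /= andbC [RHS]andbC; case: eqP => //= ->.
  by rewrite (inj_eq (@addp_nat_inj 'X^r)).
under eq_bigr => v _ do rewrite last_boxE -mulnb natrM.
rewrite -mulr_sumr -natr_card card_dep_length.
by case: eqP => [<- | _]; rewrite /= ?mul0r ?subrr // mul1r.
Qed.

Let q_neq0 : q != 0.
Proof. by rewrite pnatr_eq0 -lt0n ltnW // card_finNzRing_gt1. Qed.

Let q_pow_neq1 m : q ^+ m.+1 != 1.
Proof.
by rewrite pexprn_eq1 ?ler0n //= /q pnatr_eq1 gtn_eqF ?card_finNzRing_gt1.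
Qed.

Lemma shape_count_flat N p r : part p r.+1 = part p r ->
  shape_count N p r = shape_count N p r.+1.
Proof.
move=> flat; apply: eq_card => t; rewrite !inE; case: eqP => //= def_p.
rewrite leq_eqVlt; case: eqP => // def_r.
by have [_] := shape_partition t; rewrite def_p -def_r flat ltnn.
Qed.

Lemma shape_count_oversize N p s : (N < s)%N -> shape_count N p s = 0%N.
Proof.
move=> lt_s; apply: eq_card0 => t; rewrite inE [(s <= _)%N]leqNgt.
by rewrite (leq_ltn_trans (dep_length_leq_size t)) ?size_tuple // andbF.
Qed.

Lemma shape_count0 s :
  (shape_count 0 1 s)%:R = weight q n 1 * (1 - q ^- part 1 s).
Proof.
pose P t := (shape t == 1) && (s <= dep_length t)%N.
rewrite /shape_count (card_tuple0 P) /P shape_nil dep_length_nil eqxx leqn0 /=.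
have q_sub1 : q - 1 != 0 by rewrite subr_eq0 -[q]expr1.
rewrite /weight /chain_weight size_poly1 big_ord1 !part1 /head_weight.
rewrite /step_weight big_ord0 big_ord1 !mulr1 expr1.
case: s {P} => [|s]; last by rewrite expr0 invr1 subrr mulr0.
by rewrite eqxx /= muln0 expr0 expr1; field; rewrite q_neq0.
Qed.

Lemma shape_countS_weight N p r :
    is_partition p -> (0 < part p 0 <= n.+1)%N ->
    (part p r < part (cons_poly n.+1 p) r)%N ->
    (forall s, (shape_count N p s)%:R = weight q n p * (1 - q ^- part p s)) ->
  (shape_count N.+1 (p + 'X^r) r)%:R - (shape_count N.+1 (p + 'X^r) r.+1)%:R
  = weight q n (p + 'X^r) * (q ^- part p r.+1 - q ^- (part p r).+1).
Proof.
move=> p_dec p0_bound addable count_p.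
rewrite shape_countS !count_p weight_addXn //.
have row_gt0 : (0 < part (cons_poly n.+1 p) r)%N.
  exact: leq_ltn_trans addable.
rewrite -[in RHS](prednK row_gt0) exprS.
rewrite -[X in _ - X]mulrA (mulrC (1 - _)) expr_pred_sub1 //.
by field; rewrite q_neq0 expf_neq0.
Qed.

Lemma shape_countE N p s :
    is_partition (cons_poly n.+1 p) -> p.[1] = N.+1 ->
  (shape_count N p s)%:R = weight q n p * (1 - q ^- part p s).
Proof.
elim: N p s => [|N IHN] p s np_dec p1.
  have [_ p_dec] := (is_partition_cons _ _).1 np_dec.
  by rewrite (partition_horner1_eq1 p_dec p1) shape_count0.
have [p0_le p_dec] := (is_partition_cons _ _).1 np_dec.
pose f r : rat := (shape_count N.+1 p r)%:R.
pose g r := weight q n p * (1 - q ^- part p r).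
apply: (@eq_from_differences _ f g N.+2) => [r | r le_r]; last first.
  rewrite /f /g shape_count_oversize // part_oversize ?p1 //.
  by rewrite expr0 invr1 subrr mulr0.
have := p_dec r; rewrite leq_eqVlt => /predU1P [flat | corner].
  by rewrite /f /g (shape_count_flat _ flat) flat !subrr.
have -> : g r - g r.+1 = weight q n p * (q ^- part p r.+1 - q ^- part p r).
  by rewrite /g; ring.
have [p' [np'_dec addable def_p]] := remove_corner np_dec corner.
have p'1 : p'.[1] = N.+1 by move: p1; rewrite def_p horner1_addXn => -[].
have [p'0_le p'_dec] := (is_partition_cons _ _).1 np'_dec.
rewrite /f def_p shape_countS_weight ?part0_gt0 ?p'1 // => [|u].
  by rewrite !part_addXn eqxx gtn_eqF // addn0 addn1.
exact: IHN.
Qed.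

(** * Strata *)

(* The number of sequences of length s + k - 1 whose entries span a space of
   dimension h and whose k windows of length s have rank i. *)
Definition stratum (h s k i : nat) : nat :=
  #|[set t : (s + k).-1.-tuple 'rV[F]_n |
      (wrank 1 t == h) && (wrank s t == i)]|.

Definition span_count (h N : nat) : nat :=
  #|[set t : N.-tuple 'rV[F]_n | wrank 1 t == h]|.

Lemma wrank1_shape t : (wrank 1 t).+1 = part (shape t) 0.
Proof. by have := @wrank_shape 1 t isT; rewrite big_ord1 addn1. Qed.

Lemma wrank1_leq_dim t : (wrank 1 t <= n)%N.
Proof.
rewrite -ltnS wrank1_shape.
by have [/is_partition_cons[]] := shape_partition t.
Qed.

Lemma is_partition_shape t : is_partition (shape t).
Proof. by have [/is_partition_cons[]] := shape_partition t. Qed.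

Lemma wrank_leq_mul s t : (wrank s t <= wrank 1 t * s)%N.
Proof.
have [le_s | /wrank_oversize -> //] := leqP s (size t).
have : (\sum_(j < s) part (shape t) j <= \sum_(j < s) (wrank 1 t).+1)%N.
  apply: leq_sum => j _; rewrite wrank1_shape.
  exact: is_partition_leq (is_partition_shape t) _.
by rewrite -wrank_shape ?leqW // sum_nat_const card_ord; lia.
Qed.

(* If the windows of length s are dependent then the first s + 1 rows of the
   shape are nonempty. *)
Lemma wrank1_leq_wrank s t : (0 < s)%N -> (wrank s t < (size t).+1 - s)%N ->
  (wrank 1 t <= wrank s t)%N.
Proof.
case: s => // s _ lt_rank; have le_s : (s.+1 <= (size t).+1)%N by lia.
have part_s : (0 < part (shape t) s.+1)%N.
  rewrite lt0n; apply/eqP => /(sum_part_eq_horner1 (is_partition_shape t)).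
  by rewrite -wrank_shape // horner1_shape; lia.
have := wrank_shape le_s; rewrite big_ord_recl /= -wrank1_shape.
have : (\sum_(j < s) 1 <= \sum_(j < s) part (shape t) (bump 0 j))%N.
  apply: leq_sum => j _; apply: leq_trans part_s _.
  by apply: (is_partition_leq (is_partition_shape t)); rewrite /bump ltnS ltnW.
rewrite sum_nat_const card_ord; set rest := (\sum_(j < s) _)%N; lia.
Qed.

Lemma sum_stratum s k i :
  #|[set t : (s + k).-1.-tuple 'rV[F]_n | wrank s t == i]|
  = (\sum_(h < n.+1) stratum h s k i)%N.
Proof.
pose span_dim (t : (s + k).-1.-tuple 'rV[F]_n) : 'I_n.+1 := inord (wrank 1 t).
rewrite -sum1dep_card (partition_big span_dim xpredT) //=.
apply: eq_bigr => h _; rewrite /stratum -sum1dep_card; apply: eq_bigl => t.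
by rewrite andbC -(inj_eq val_inj) /= inordK // ltnS wrank1_leq_dim.
Qed.

Lemma stratum_height1 h k : stratum h 1 k h = span_count h k.
Proof. by apply: eq_card => t; rewrite !inE andbb. Qed.

Lemma stratum_height1_neq h k i : i != h -> stratum h 1 k i = 0%N.
Proof.
move=> neq_i; apply: eq_card0 => t; rewrite inE.
by case: eqP => // ->; rewrite eq_sym (negPf neq_i).
Qed.

Lemma stratum_small h s k i :
  (0 < s)%N -> (i < h)%N -> (i < k)%N -> stratum h s k i = 0%N.
Proof.
move=> s_gt0 lt_ih lt_ik; apply: eq_card0 => t; rewrite inE.
apply/andP => -[/eqP rank1 /eqP ranks].
have : (wrank 1 t <= wrank s t)%N.
  by rewrite wrank1_leq_wrank // size_tuple ranks; lia.
by rewrite rank1 ranks; lia.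
Qed.

Lemma stratum_square h s k : (0 < s)%N -> (k <= h)%N ->
  stratum h s k k = span_count h (s + k).-1.
Proof.
move=> s_gt0 le_kh; apply: eq_card => t; rewrite !inE.
case: eqP => //= rank1; rewrite eqn_leq; apply/andP; split.
  by apply: leq_trans (rank_leq_row _) _; rewrite size_tuple; lia.
rewrite leqNgt; apply/negP => lt_k.
have : (wrank 1 t <= wrank s t)%N.
  apply: wrank1_leq_wrank => //; apply: leq_trans lt_k _.
  by rewrite size_tuple; lia.
by rewrite rank1 leqNgt (leq_trans lt_k).
Qed.

Lemma stratum_large h s k i : (h * s < i)%N -> stratum h s k i = 0%N.
Proof.
move=> lt_i; apply: eq_card0 => t; rewrite inE.
apply/andP => -[/eqP rank1 /eqP ranks].
by have := wrank_leq_mul s t; rewrite rank1 ranks leqNgt lt_i.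
Qed.

Lemma card_first_window_dep1 t :
  #|[set v | first_window_dep 1 (v :: t)]| = (#|F| ^ wrank 1 t)%N.
Proof. by rewrite card_first_window_dep ?first_window_dep0 // wrank0 subn0. Qed.

Lemma span_countS h N :
  (span_count h N.+1)%:R
  = q ^+ h * (span_count h N)%:R
    + (if h is h'.+1 then (q ^+ n - q ^+ h') * (span_count h' N)%:R else 0)
  :> rat.
Proof.
have eq_mul (x y : nat) (c : nat -> rat) :
    (x == y)%:R * c x = c y * (x == y)%:R.
  by case: eqP => [-> | _]; rewrite ?mulr1 ?mul1r ?mulr0 ?mul0r.
have sum_cons t : \sum_v (wrank 1 (v :: t) == h)%:R
    = (wrank 1 t == h)%:R * q ^+ wrank 1 t
      + ((wrank 1 t).+1 == h)%:R * (q ^+ n - q ^+ wrank 1 t) :> rat.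
  have -> : q ^+ wrank 1 t = \sum_v (first_window_dep 1 (v :: t))%:R.
    by rewrite -natr_card card_first_window_dep1 natrX.
  have -> : q ^+ n = \sum_(v : 'rV[F]_n) 1.
    by rewrite sumr_const card_mx mul1n natrX.
  rewrite -sumrB !mulr_sumr -big_split /=; apply: eq_bigr => v _.
  rewrite wrank_cons //; case: first_window_dep => /=.
    by rewrite addn0 subrr mulr0 addr0 mulr1.
  by rewrite addn1 subr0 mulr0 add0r mulr1.
rewrite /span_count natr_card.
rewrite (big_tuple_cons _ (fun t => (wrank 1 t == h)%:R)).
under eq_bigr do rewrite sum_cons (eq_mul _ _ (fun r => q ^+ r)).
rewrite big_split -mulr_sumr -natr_card /=; congr (_ + _).
case: h {sum_cons} => [|h]; first by rewrite big1 // => t _; rewrite mul0r.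
under eq_bigr do rewrite eqSS (eq_mul _ _ (fun r => q ^+ n - q ^+ r)).
by rewrite -mulr_sumr -natr_card.
Qed.

Lemma span_count_nil h : span_count h 0 = (h == 0%N).
Proof.
pose P (t : seq 'rV[F]_n) := wrank 1 t == h.
by rewrite /span_count (card_tuple0 P) /P wrank_oversize // eq_sym.
Qed.

Lemma span_count0 N : span_count 0 N = 1%N.
Proof.
elim: N => [|N IHN]; first by rewrite span_count_nil.
by apply/eqP; rewrite -(eqr_nat rat) span_countS expr0 mul1r addr0 IHN.
Qed.

Lemma stratum0 s k i : stratum 0 s k i = (i == 0%N).
Proof.
rewrite -[RHS]muln1 -(span_count0 (s + k).-1).
have wrank_s t : wrank 1 t = 0%N -> wrank s t = 0%N.
  by move=> rank1; apply/eqP; have := wrank_leq_mul s t; rewrite rank1 leqn0.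
case: eqVneq => [-> | i_neq0]; rewrite ?mul1n ?mul0n.
  by apply: eq_card => t; rewrite !inE; case: eqP => //= /wrank_s ->.
apply: eq_card0 => t; rewrite inE; case: eqP => //= /wrank_s ->.
by rewrite eq_sym (negPf i_neq0).
Qed.

(** * Recursion on the length of the windows *)

(* Ratio of the numbers of sequences of shapes (h + 1, p_0, p_1, ...) and
   (p_0, p_1, ...), which only depends on h and g = p_0 - 1. *)
Definition lift_coef h g : rat :=
  if (g <= h)%N then
    head_weight q n h.+1 * (1 - q ^- h.+1) * step_weight q h.+1 g.+1
    / (head_weight q n g.+1 * (1 - q ^- g.+1))
  else 0.

Lemma lift_coef_diag h : (h <= n)%N -> lift_coef h h = q ^+ (h.+1 * h).
Proof.
move=> le_hn; rewrite /lift_coef leqnn /step_weight subnn big_ord0 /=; field.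
by rewrite head_weight_neq0 // expf_neq0 //= subr_eq0 q_pow_neq1.
Qed.

Lemma shape_count_gt0 N p s : (0 < shape_count N p s)%N ->
  is_partition (cons_poly n.+1 p) /\ p.[1] = N.+1.
Proof.
case/card_gt0P => t; rewrite inE => /andP [/eqP <- _].
by rewrite horner1_shape size_tuple; have [] := shape_partition t.
Qed.

Lemma shape_count_cons_partition h N p : (h <= n)%N ->
    is_partition (cons_poly h.+1 p) -> p.[1] = N.+1 ->
  (shape_count (N + h.+1) (cons_poly h.+1 p) 0)%:R
  = lift_coef h (part p 0).-1 * (shape_count N p 0)%:R.
Proof.
move=> le_hn hp_dec p1; have [p0_le p_dec] := (is_partition_cons _ _).1 hp_dec.
have p0_gt0 : (0 < part p 0)%N by rewrite part0_gt0 // p1.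
have p0_le_n : (part p 0 <= n.+1)%N by apply: leq_trans p0_le _.
rewrite !shape_countE //; last 3 first.
- exact/is_partition_cons.
- by apply/is_partition_cons; rewrite part_cons.
- by rewrite horner1_cons p1 addSn.
rewrite /weight chain_weight_cons // !part_cons /lift_coef prednK //.
rewrite -ltnS prednK // p0_le; field.
rewrite head_weight_neq0 // !expf_neq0 //= subr_eq0 andbT.
by rewrite -(prednK p0_gt0) q_pow_neq1.
Qed.

Lemma shape_count_cons h N p : (h <= n)%N ->
  (shape_count (N + h.+1) (cons_poly h.+1 p) 0)%:R
  = lift_coef h (part p 0).-1 * (shape_count N p 0)%:R.
Proof.
move=> le_hn; case: (posnP (shape_count N p 0)) => [no_p | /shape_count_gt0].
  rewrite no_p mulr0; apply/eqP; rewrite pnatr_eq0 -leqn0 leqNgt.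
  apply/negP => cons_gt0; have [cons_part] := shape_count_gt0 cons_gt0.
  have [_ cons_dec] := (is_partition_cons _ _).1 cons_part.
  rewrite horner1_cons -addSn => /addIn p1; move: cons_gt0.
  by rewrite -(ltr_nat rat) shape_count_cons_partition // no_p mulr0 ltxx.
case=> /is_partition_cons [p0_le p_dec] p1.
case: (leqP (part p 0) h.+1) => [le_h | gt_h].
  by apply: shape_count_cons_partition => //; apply/is_partition_cons.
rewrite /lift_coef leqNgt -ltnS prednK ?gt_h ?(ltn_trans _ gt_h) // mul0r.
apply/eqP; rewrite pnatr_eq0 -leqn0 leqNgt; apply/negP => /shape_count_gt0 [].
by case/is_partition_cons => _ /is_partition_cons []; rewrite leqNgt gt_h.
Qed.

Lemma lift_coef_sum h (g : nat) (b : bool) :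
  \sum_(g' < h.+1) lift_coef h g' * ((g == g' :> nat) && b)%:R
  = lift_coef h g * b%:R.
Proof.
case: (ltnP g h.+1) => [lt_gh | le_hg].
  rewrite (bigD1 (Ordinal lt_gh)) //= eqxx big1 ?addr0 // => g' /negPf neq_g.
  by rewrite eq_sym -(inj_eq val_inj) /= in neq_g *; rewrite neq_g mulr0.
rewrite [in RHS]/lift_coef leqNgt le_hg mul0r big1 // => g' _.
by rewrite gtn_eqF ?mulr0 // (leq_trans (ltn_ord g')).
Qed.

Lemma natr_card_cons_shape h N (P : pred {poly nat}) : (h <= n)%N ->
    (forall p, P p -> part p 0 = h.+1) ->
  #|[set t : (N + h.+1).-tuple 'rV[F]_n | P (shape t)]|%:R
  = \sum_(t : N.-tuple 'rV[F]_n)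
      lift_coef h (wrank 1 t) * (P (cons_poly h.+1 (shape t)))%:R.
Proof.
move=> le_hn headP.
have shape_countT M p :
    #|[set t : M.-tuple 'rV[F]_n | shape t == p]| = shape_count M p 0.
  by apply: eq_card => t; rewrite !inE leq0n andbT.
pose lift (t : N.-tuple 'rV[F]_n) := cons_poly h.+1 (shape t).
pose c p := lift_coef h (part p 1).-1.
rewrite (@natr_card_weighted_fibers _ _ _ _ _ lift P c) => [|p /headP].
  by apply: eq_bigr => t _; rewrite /c /lift part_cons -wrank1_shape.
have [x [p' ->]] := poly_is_cons p; rewrite /c !part_cons => ->.
rewrite shape_countT shape_count_cons // -shape_countT; congr (_ * _%:R).
by apply: eq_card => t; rewrite !inE /lift (inj_eq (@cons_poly_inj _)).
Qed.

(* Prepending the row h + 1 to the shape amounts to adding 1 to the h + 1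
   largest parts of the splitting type. *)
Lemma stratumS h s k i :
    (h <= n)%N -> (0 < s)%N -> (h <= k)%N -> (h <= i)%N ->
  (stratum h s.+1 k i)%:R
  = \sum_(g < h.+1) lift_coef h g * (stratum g s (k - h) (i - h))%:R.
Proof.
move=> le_hn s_gt0 le_hk le_hi; rewrite /stratum; set N := (s + (k - h)).-1.
have -> : ((s.+1 + k).-1 = N + h.+1)%N by rewrite /N; lia.
pose P (p : {poly nat}) :=
  (part p 0 == h.+1) && (\sum_(j < s.+1) part p j == i + s.+1)%N.
transitivity (#|[set t : (N + h.+1).-tuple 'rV[F]_n | P (shape t)]|%:R : rat).
  congr _%:R; apply: eq_card => t; rewrite !inE /P -wrank1_shape eqSS.
  by rewrite -wrank_shape ?eqn_add2r // size_tuple /N; lia.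
rewrite natr_card_cons_shape // => [|p /andP [/eqP]] //.
under [RHS]eq_bigr do rewrite natr_card mulr_sumr.
rewrite exchange_big; apply: eq_bigr => t _ /=.
rewrite lift_coef_sum /P part_cons eqxx big_ord_recl part_cons /=.
under eq_bigr do rewrite part_cons.
rewrite -wrank_shape; last by rewrite size_tuple /N; lia.
have -> : (i + s.+1 = h.+1 + (i - h + s))%N by lia.
by rewrite eqn_add2l eqn_add2r.
Qed.

Lemma stratum_shift h s k i j : (h <= n)%N -> (0 < s)%N -> (h.-1 * s < i)%N ->
  stratum h (s + j) (k + h * j) (i + h * j)
  = ((#|F| ^ (h.+1 * h)) ^ j * stratum h s k i)%N.
Proof.
move=> le_hn s_gt0 lt_i.
elim: j => [|j IHj]; first by rewrite muln0 !addn0 mul1n.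
apply/eqP; rewrite -(eqr_nat rat) addnS; apply/eqP.
rewrite stratumS //; try lia.
have -> : (k + h * j.+1 - h = k + h * j)%N by lia.
have -> : (i + h * j.+1 - h = i + h * j)%N by lia.
rewrite big_ord_recr /= big1 => [|g _].
  by rewrite add0r IHj lift_coef_diag // expnS -mulnA [RHS]natrM natrX.
by rewrite stratum_large ?mulr0 //; have := ltn_ord g; nia.
Qed.

(** * Hankel matrices *)

Definition hankel s k t (m : 'I_n) : 'M[F]_(s, k) :=
  \matrix_(i, j) nth 0 t (i + j) 0 m.

Lemma mul_hankel_tr_eq0 k s t (z : 'rV_k) m :
  z *m (hankel s k t m)^T = 0 <->
  forall i : 'I_s, \sum_j z 0 j * nth 0 t (i + j) 0 m = 0.
Proof.
have mulE i :
    (z *m (hankel s k t m)^T) 0 i = \sum_j z 0 j * nth 0 t (i + j) 0 m.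
  by rewrite mxE; apply: eq_bigr => j _; rewrite !mxE.
split=> [z0 i | z0]; first by rewrite -mulE z0 mxE.
by apply/rowP => i; rewrite mulE z0 mxE.
Qed.

Lemma mul_windows_eq0 k s t (z : 'rV_k) :
  z *m windows t k s = 0 <-> forall m, z *m (hankel s k t m)^T = 0.
Proof.
elim: s t => [|s IHs] t; first by split=> [_ m | _]; apply/matrixP => i [].
rewrite [windows _ _ _]/= (mul_mx_row z); split=> [/eqP | z_t].
  rewrite row_mx_eq0 => /andP [/eqP/rowP z_t /eqP/IHs z_bt] m.
  apply/mul_hankel_tr_eq0 => i; case: (unliftP ord0 i) => [i'|] ->.
    have /mul_hankel_tr_eq0/(_ i') sum0 := z_bt m; rewrite -[RHS]sum0.
    by apply: eq_bigr => j _; rewrite nth_behead.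
  have := z_t m; rewrite !mxE => z_tm; rewrite -[RHS]z_tm.
  by apply: eq_bigr => j _; rewrite !mxE.
rewrite -[RHS]row_mx0; congr row_mx.
  apply/rowP => m; rewrite !mxE.
  have /mul_hankel_tr_eq0/(_ ord0) sum0 := z_t m; rewrite -[RHS]sum0.
  by apply: eq_bigr => j _; rewrite !mxE.
apply/IHs => m; apply/mul_hankel_tr_eq0 => i.
have /mul_hankel_tr_eq0/(_ (lift ord0 i)) sum0 := z_t m; rewrite -[RHS]sum0.
by apply: eq_bigr => j _; rewrite nth_behead.
Qed.

Lemma hankel_inj s k (t t' : (s.+1 + k.+1).-1.-tuple 'rV[F]_n) :
  (forall m, hankel s.+1 k.+1 t m = hankel s.+1 k.+1 t' m) -> t = t'.
Proof.
move=> eq_hankel; apply: val_inj.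
apply: (@eq_from_nth _ 0); rewrite !size_tuple // => d lt_d; apply/rowP => m.
have /matrixP/(_ (inord (minn d s)) (inord (d - s))) := eq_hankel m.
rewrite !mxE !inordK; [|lia..].
by rewrite (_ : minn d s + (d - s) = d)%N //; lia.
Qed.

End Windows.

Section TripleHankel.
Variable F : finFieldType.

Lemma ord3_ind (P : 'I_3 -> Prop) : P 0 -> P 1 -> P 2 -> forall m, P m.
Proof.
move=> P0 P1 P2 [[|[|[|//]]] lt_m].
- by rewrite (_ : Ordinal lt_m = 0) //; apply: val_inj.
- by rewrite (_ : Ordinal lt_m = 1) //; apply: val_inj.
- by rewrite (_ : Ordinal lt_m = 2) //; apply: val_inj.
Qed.

Definition triple_hankel s k (t : seq 'rV[F]_3) : 'M[F]_(s + (s + s), k) :=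
  col_mx (hankel s k t 0) (col_mx (hankel s k t 1) (hankel s k t 2)).

Lemma rank_triple_hankel s k (t : (s + k).-1.-tuple 'rV[F]_3) : (0 < k)%N ->
  \rank (triple_hankel s k t) = wrank s t.
Proof.
move=> k_gt0; rewrite /wrank size_tuple.
have -> : ((s + k).-1 + 1 - s = k)%N by lia.
rewrite -mxrank_tr; apply: eq_left_kernel_mxrank => z.
apply: iff_trans (iff_sym (mul_windows_eq0 _ _ _)).
rewrite /triple_hankel !tr_col_mx !mul_mx_row; split=> [/eqP | z_t].
  by rewrite !row_mx_eq0 => /and3P [/eqP ? /eqP ? /eqP ?]; apply: ord3_ind.
by rewrite !z_t !row_mx0.
Qed.

End TripleHankel.

Lemma persymmetric_hankel n s k (t : seq 'rV['F_2]_n) m :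
  persymmetric (hankel s k t m).
Proof.
do 4!apply/forallP => ?; apply/implyP => /eqP eq_sum.
by rewrite !mxE eq_sum.
Qed.

Definition antidiagonal s k (A : 'M['F_2]_(s.+1, k.+1)) d : 'F_2 :=
  A (inord (minn d s)) (inord (d - s)).

Lemma persymmetricE s k (A : 'M['F_2]_(s.+1, k.+1)) i j :
  persymmetric A -> A i j = antidiagonal A (i + j).
Proof.
have := ltn_ord i; have := ltn_ord j => lt_j lt_i.
move=> /forallP/(_ i)/forallP/(_ j).
move=> /forallP/(_ (inord (minn (i + j) s)))/forallP/(_ (inord (i + j - s))).
by move=> /implyP A_sym; apply/eqP/A_sym; rewrite !inordK; lia.
Qed.

Lemma triple_persymmetric_hankel s k
    (M : 'M['F_2]_(s.+1 + (s.+1 + s.+1), k.+1)) :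
  triple_persymmetric M ->
  exists t : (s.+1 + k.+1).-1.-tuple 'rV_3, M = triple_hankel s.+1 k.+1 t.
Proof.
case/and3P => A_sym B_sym C_sym.
pose entry d : 'rV['F_2]_3 := \row_m nth 0 [:: antidiagonal (usubmx M) d;
  antidiagonal (usubmx (dsubmx M)) d; antidiagonal (dsubmx (dsubmx M)) d] m.
exists [tuple of mkseq entry (s.+1 + k.+1).-1].
have lt_sum (i : 'I_s.+1) (j : 'I_k.+1) : (i + j < (s.+1 + k.+1).-1)%N.
  by have := ltn_ord i; have := ltn_ord j; lia.
rewrite -[LHS]vsubmxK -[dsubmx M in LHS]vsubmxK.
congr col_mx; last congr col_mx; apply/matrixP => i j.
all: by rewrite persymmetricE // [RHS]mxE nth_mkseq // mxE.
Qed.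

Lemma Gamma_wrank i s k : (0 < s)%N -> (0 < k)%N ->
  Gamma i s s s k = #|[set t : (s + k).-1.-tuple 'rV['F_2]_3 | wrank s t == i]|.
Proof.
case: s k => [|s] [|k] // _ _.
have triple_hankel_inj : injective
    (fun t : (s.+1 + k.+1).-1.-tuple 'rV['F_2]_3 => triple_hankel s.+1 k.+1 t).
  move=> t t' eq_tt'; have [eq0 /eq_col_mx [eq1 eq2]] := eq_col_mx eq_tt'.
  by apply: hankel_inj; apply: ord3_ind.
rewrite /Gamma -[RHS](card_imset _ triple_hankel_inj); apply: eq_card => M.
rewrite inE; apply/andP/imsetP => [[M_sym /eqP rankM] | [t]].
  have [t def_M] := triple_persymmetric_hankel M_sym.
  by exists t; rewrite // inE -rank_triple_hankel // -def_M rankM.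
rewrite inE => /eqP rank_t ->; rewrite rank_triple_hankel // rank_t eqxx.
rewrite /triple_persymmetric col_mxKu !col_mxKd col_mxKu.
by rewrite !persymmetric_hankel.
Qed.

(** * Closed forms over F_2 *)

Local Notation pw m := (2 ^+ m : rat).
Local Notation stratumQ h s k i := ((stratum 'F_2 3 h s k i)%:R : rat).
Local Notation span_countQ h N := ((span_count 'F_2 3 h N)%:R : rat).

Lemma span_count_F2_3 N :
  [/\ span_countQ 1 N = 7 * (pw N - 1),
      span_countQ 2 N = 7 * (pw N - 1) * (pw N - 2)
    & span_countQ 3 N = (pw N - 1) * (pw N - 2) * (pw N - 4)].
Proof.
elim: N => [|N [IH1 IH2 IH3]].
  by rewrite !span_count_nil expr0; split=> /=; ring.
rewrite !span_countS card_Fp // span_count0 IH1 IH2 IH3 (exprS _ N).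
by move: (pw N) => x; split; ring.
Qed.

Ltac lift_coef_compute :=
  rewrite /lift_coef /head_weight /step_weight (card_Fp (isT : prime 2));
  rewrite !big_ord_recl !big_ord0;
  let q := fresh "q" in set q : rat := 2; rewrite /= /bump ?leq0n ?add1n /= /q.

Lemma lift_coef1 : lift_coef 'F_2 3 1 0 = 21 /\ lift_coef 'F_2 3 1 1 = 4.
Proof. lift_coef_compute; split; field; exact: isT. Qed.

Lemma lift_coef2 :
  [/\ lift_coef 'F_2 3 2 0 = 294, lift_coef 'F_2 3 2 1 = 168
    & lift_coef 'F_2 3 2 2 = 64].
Proof. by lift_coef_compute; split; field; exact: isT. Qed.

Lemma lift_coef3 :
  [/\ lift_coef 'F_2 3 3 0 = 2520, lift_coef 'F_2 3 3 1 = 3360,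
      lift_coef 'F_2 3 3 2 = 3840 & lift_coef 'F_2 3 3 3 = 4096].
Proof. by lift_coef_compute; split; field; exact: isT. Qed.

Lemma stratum1S s k i : (0 < s)%N -> (0 < k)%N -> (0 < i)%N ->
  stratumQ 1 s.+1 k i
  = 4 * stratumQ 1 s (k - 1) (i - 1) + 21 * stratumQ 0 s (k - 1) (i - 1).
Proof.
move=> s_gt0 le_hk le_hi; have [coef0 coef1] := lift_coef1.
rewrite (stratumS _ (isT : 1 <= 3)%N s_gt0 le_hk le_hi).
by rewrite !big_ord_recr big_ord0 /= coef0 coef1; ring.
Qed.

Lemma stratum2S s k i : (0 < s)%N -> (1 < k)%N -> (1 < i)%N ->
  stratumQ 2 s.+1 k i
  = 64 * stratumQ 2 s (k - 2) (i - 2) + 168 * stratumQ 1 s (k - 2) (i - 2)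
    + 294 * stratumQ 0 s (k - 2) (i - 2).
Proof.
move=> s_gt0 le_hk le_hi; have [coef0 coef1 coef2] := lift_coef2.
rewrite (stratumS _ (isT : 2 <= 3)%N s_gt0 le_hk le_hi).
by rewrite !big_ord_recr big_ord0 /= coef0 coef1 coef2; ring.
Qed.

Lemma stratum3S s k i : (0 < s)%N -> (2 < k)%N -> (2 < i)%N ->
  stratumQ 3 s.+1 k i
  = 4096 * stratumQ 3 s (k - 3) (i - 3) + 3840 * stratumQ 2 s (k - 3) (i - 3)
    + 3360 * stratumQ 1 s (k - 3) (i - 3) + 2520 * stratumQ 0 s (k - 3) (i - 3).
Proof.
move=> s_gt0 le_hk le_hi; have [coef0 coef1 coef2 coef3] := lift_coef3.
rewrite (stratumS _ (isT : 3 <= 3)%N s_gt0 le_hk le_hi).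
by rewrite !big_ord_recr big_ord0 /= coef0 coef1 coef2 coef3; ring.
Qed.

Lemma stratum0_0 s k : stratumQ 0 s k 0 = 1.
Proof. by rewrite stratum0. Qed.

Lemma stratum0_pos s k i : (0 < i)%N -> stratumQ 0 s k i = 0.
Proof. by rewrite stratum0; case: i. Qed.

Lemma pwB m r : (r <= m)%N -> pw (m - r) = pw m / pw r.
Proof. by move=> le_rm; rewrite exprB ?unitfE. Qed.

Ltac pow_field :=
  try lia; rewrite ?pwB; try lia; rewrite ?(exprS (2 : rat)) ?(exprD (2 : rat));
  field; exact: isT.

Lemma stratum1_low s k i : (0 < i)%N -> (i < s)%N -> (i < k)%N ->
  stratumQ 1 s k i = 21 / 4 * pw i ^+ 2.
Proof.
elim: s k i => [|s IHs] k i i_gt0 lt_is lt_ik; first by lia.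
rewrite stratum1S; try lia; case: (ltnP 1 i) => [i_gt1 | i_le1].
  by rewrite IHs ?stratum0_pos; pow_field.
have -> : i = 1%N by lia.
by rewrite subnn stratum0_0 stratum_small; pow_field.
Qed.

Lemma stratum1_top s k : (0 < s)%N -> (s <= k)%N ->
  stratumQ 1 s k s = 7 / 2 * pw s * pw k - 7 / 4 * pw s ^+ 2.
Proof.
case: s => [|s] s_gt0; first by lia.
elim: s {s_gt0} k => [|s IHs] k le_sk.
  by rewrite stratum_height1; have [-> _ _] := span_count_F2_3 k; pow_field.
by rewrite stratum1S ?subSS ?subn0 ?IHs ?stratum0_pos; pow_field.
Qed.

Lemma stratum2_low s k i : (0 < i)%N -> (i <= s)%N -> (i < k)%N ->
  stratumQ 2 s k i = 147 / 16 * pw i ^+ 3 - 147 / 8 * pw i ^+ 2.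
Proof.
elim: s k i => [|s IHs] k i i_gt0 le_is lt_ik; first by lia.
case: (ltnP 1 i) => [i_gt1 | i_le1]; last first.
  have def_i : i = 1%N by lia.
  by rewrite def_i stratum_small; pow_field.
rewrite stratum2S; try lia; case: (ltnP 2 i) => [i_gt2 | i_le2].
  by rewrite IHs ?stratum1_low ?stratum0_pos; pow_field.
have -> : i = 2%N by lia.
by rewrite subnn stratum0_0 !stratum_small; pow_field.
Qed.

Lemma stratum2_mid s j k : (0 < j)%N -> (j < s)%N -> (s + j < k)%N ->
  stratumQ 2 s k (s + j)
  = 147 / 16 * pw s * pw k * pw j ^+ 3 - 735 / 32 * pw s ^+ 2 * pw j ^+ 4
    + 147 / 16 * pw s ^+ 3 * pw j ^+ 3.
Proof.
elim: s j k => [|s IHs] j k j_gt0 lt_js lt_k; first by lia.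
rewrite stratum2S; try lia.
have -> : (s.+1 + j - 2 = s + (j - 1))%N by lia.
case: (ltnP 1 j) => [j_gt1 | j_le1].
  by rewrite IHs ?stratum_large; pow_field.
have -> : j = 1%N by lia.
by rewrite addn0 stratum2_low ?stratum1_top ?stratum0_pos; pow_field.
Qed.

Lemma stratum2_top s k : (0 < s)%N -> (2 * s <= k)%N ->
  stratumQ 2 s k (2 * s)
  = 7 / 4 * pw s ^+ 2 * pw k ^+ 2 - 21 / 16 * pw s ^+ 4 * pw k
    + 7 / 32 * pw s ^+ 6.
Proof.
case: s => [|s] s_gt0; first by lia.
elim: s {s_gt0} k => [|s IHs] k le_k.
  by rewrite stratum_height1; have [_ -> _] := span_count_F2_3 k; pow_field.
have -> : (2 * s.+2 = 2 * s.+1 + 2)%N by lia.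
rewrite stratum2S ?addnK ?IHs ?stratum_large; pow_field.
Qed.

Lemma stratum3_low s k i : (0 < i)%N -> (i <= s)%N -> (i < k)%N ->
  stratumQ 3 s k i
  = 105 / 8 * pw i ^+ 2 - 315 / 32 * pw i ^+ 3 + 105 / 64 * pw i ^+ 4.
Proof.
elim: s k i => [|s IHs] k i i_gt0 le_is lt_ik; first by lia.
case: (ltnP 2 i) => [i_gt2 | i_le2]; last first.
  have [def_i | def_i] : i = 1%N \/ i = 2%N by lia.
    by rewrite def_i stratum_small; pow_field.
  by rewrite def_i stratum_small; pow_field.
rewrite stratum3S; try lia; case: (ltnP 3 i) => [i_gt3 | i_le3].
  by rewrite IHs ?stratum2_low ?stratum1_low ?stratum0_pos; pow_field.
have -> : i = 3%N by lia.
by rewrite subnn stratum0_0 !stratum_small; pow_field.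
Qed.

Lemma stratum3_mid s j k : (0 < j)%N -> (j < s)%N -> (s + j < k)%N ->
  stratumQ 3 s k (s + j)
  = - (735 / 64) * pw s * pw k * pw j ^+ 3
    + 735 / 128 * pw s * pw k * pw j ^+ 4
    + 3675 / 128 * pw s ^+ 2 * pw j ^+ 4 - 3255 / 256 * pw s ^+ 2 * pw j ^+ 5
    - 315 / 32 * pw s ^+ 3 * pw j ^+ 3 + 105 / 64 * pw s ^+ 4 * pw j ^+ 4.
Proof.
elim: s j k => [|s IHs] j k j_gt0 lt_js lt_k; first by lia.
rewrite stratum3S; try lia.
case: (ltnP 2 j) => [j_gt2 | j_le2].
  have -> : (s.+1 + j - 3 = s + (j - 2))%N by lia.
  by rewrite IHs ?stratum2_mid ?stratum_large; pow_field.
have [def_j | def_j] : j = 1%N \/ j = 2%N by lia.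
  have [-> | s_gt1] : s = 1%N \/ (1 < s)%N by lia.
    rewrite def_j !addn1 subnn stratum0_0.
    by rewrite !stratum_small; pow_field.
  have -> : (s.+1 + j - 3 = s - 1)%N by lia.
  by rewrite def_j stratum3_low ?stratum2_low ?stratum1_low ?stratum0_pos;
    pow_field.
have -> : (s.+1 + j - 3 = s)%N by lia.
by rewrite def_j stratum3_low ?stratum2_low ?stratum1_top ?stratum0_pos;
  pow_field.
Qed.

Lemma stratum3_double s k : (0 < s)%N -> (2 * s < k)%N ->
  stratumQ 3 s k (2 * s)
  = - (735 / 64) * pw s ^+ 4 * pw k + 735 / 128 * pw s ^+ 5 * pw k
    + 2415 / 128 * pw s ^+ 6 - 3255 / 256 * pw s ^+ 7 + 105 / 64 * pw s ^+ 8.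
Proof.
case: s => [|[|[|s]]] s_gt0 lt_k; first by lia.
- by rewrite stratum_height1_neq; pow_field.
- rewrite stratum3S; try lia; have -> : (2 * 2 - 3 = 1)%N by [].
  rewrite stratum1_top ?stratum0_pos; try lia.
  by rewrite !stratum_small; pow_field.
rewrite stratum3S; try lia.
have -> : (2 * s.+3 - 3 = s.+2 + s.+1)%N by lia.
by rewrite stratum3_mid ?stratum2_mid ?stratum_large; pow_field.
Qed.

Lemma stratum3_high s j k : (j + 2 <= s)%N -> (2 * s + 1 + j < k)%N ->
  stratumQ 3 s k (2 * s + 1 + j)
  = 105 / 4 * pw k ^+ 2 * pw s ^+ 2 * pw j ^+ 4
    + 735 / 8 * pw k * pw s ^+ 5 * pw j ^+ 4
    - 3255 / 8 * pw k * pw s ^+ 4 * pw j ^+ 5 + 105 / 4 * pw s ^+ 8 * pw j ^+ 4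
    - 3255 / 8 * pw s ^+ 7 * pw j ^+ 5 + 9765 / 8 * pw s ^+ 6 * pw j ^+ 6.
Proof.
elim: s j k => [|s IHs] j k le_js lt_k; first by lia.
rewrite stratum3S; try lia; case: j le_js lt_k => [|j] le_js lt_k.
  have -> : (2 * s.+1 + 1 + 0 - 3 = 2 * s)%N by lia.
  by rewrite stratum3_double ?stratum2_top ?stratum_large; pow_field.
have -> : (2 * s.+1 + 1 + j.+1 - 3 = 2 * s + 1 + j)%N by lia.
by rewrite IHs ?stratum_large; pow_field.
Qed.

Lemma stratum3_top s k : (0 < s)%N -> (3 * s <= k)%N ->
  stratumQ 3 s k (3 * s)
  = 1 / 8 * pw k ^+ 3 * pw s ^+ 3 - 7 / 64 * pw k ^+ 2 * pw s ^+ 6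
    + 7 / 256 * pw k * pw s ^+ 9 - 1 / 512 * pw s ^+ 12.
Proof.
case: s => [|s] s_gt0; first by lia.
elim: s {s_gt0} k => [|s IHs] k le_k.
  by rewrite stratum_height1; have [_ _ ->] := span_count_F2_3 k; pow_field.
have -> : (3 * s.+2 = 3 * s.+1 + 3)%N by lia.
by rewrite stratum3S ?addnK ?IHs ?stratum_large; pow_field.
Qed.

Lemma stratum1_square_low s k : (0 < s)%N -> (0 < k)%N -> (k <= s + 1)%N ->
  stratumQ 1 s k k = 7 / 2 * pw s * pw k - 7 / 4 * pw k ^+ 2.
Proof.
elim: s k => [|s IHs] k s_gt0 k_gt0 le_k; first by lia.
case: (ltnP 1 k) => [k_gt1 | k_le1].
  have [def_s | s_pos] := posnP s.
    have def_k : k = 2%N by lia.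
    by rewrite def_s def_k stratum_height1_neq; pow_field.
  by rewrite stratum1S ?IHs ?stratum0_pos; pow_field.
have def_k : k = 1%N by lia.
rewrite def_k stratum_square // addn1.
by have [-> _ _] := span_count_F2_3 s.+1; pow_field.
Qed.

Lemma stratum2_square_low s k : (0 < s)%N -> (0 < k)%N -> (k <= s + 1)%N ->
  stratumQ 2 s k k
  = 49 / 8 * pw k ^+ 2 - 21 / 16 * pw k ^+ 3 - 21 / 2 * pw s * pw k
    + 7 / 4 * pw s ^+ 2 * pw k ^+ 2.
Proof.
elim: s k => [|s IHs] k s_gt0 k_gt0 le_k; first by lia.
case: (ltnP 2 k) => [k_gt2 | k_le2].
  by rewrite stratum2S ?IHs ?stratum1_square_low ?stratum0_pos; pow_field.
have [_ count2 _] := span_count_F2_3 (s + k).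
rewrite stratum_square // addSn /= count2.
have small : k = 1%N \/ k = 2%N by lia.
by case: small => ->; pow_field.
Qed.

Lemma stratum2_square_mid s j : (0 < s)%N -> (0 < j)%N -> (j <= s + 1)%N ->
  stratumQ 2 s (s + j) (s + j)
  = 7 / 32 * pw s ^+ 2 * pw j ^+ 4 - 21 / 16 * pw s ^+ 3 * pw j ^+ 3
    + 7 / 4 * pw s ^+ 4 * pw j ^+ 2.
Proof.
elim: s j => [|s IHs] j s_gt0 j_gt0 le_j; first by lia.
have [def_s | s_pos] := posnP s.
  have [-> | ->] : j = 1%N \/ j = 2%N by lia.
    have [_ count2 _] := span_count_F2_3 2.
    by rewrite def_s stratum_height1 count2; pow_field.
  by rewrite def_s stratum_height1_neq; pow_field.
rewrite stratum2S; try lia; have -> : (s.+1 + j - 2 = s + (j - 1))%N by lia.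
case: (ltnP 1 j) => [j_gt1 | j_le1].
  by rewrite IHs ?stratum_large; pow_field.
have -> : j = 1%N by lia.
by rewrite addn0 stratum2_square_low ?stratum1_square_low ?stratum0_pos;
  pow_field.
Qed.

Lemma stratum3_square_low s k : (0 < s)%N -> (0 < k)%N -> (k <= s + 1)%N ->
  stratumQ 3 s k k
  = - (35 / 8) * pw k ^+ 2 + 45 / 32 * pw k ^+ 3 - 7 / 64 * pw k ^+ 4
    + 7 * pw s * pw k - 7 / 4 * pw s ^+ 2 * pw k ^+ 2
    + 1 / 8 * pw s ^+ 3 * pw k ^+ 3.
Proof.
elim: s k => [|s IHs] k s_gt0 k_gt0 le_k; first by lia.
case: (ltnP 3 k) => [k_gt3 | k_le3].
  by rewrite stratum3S ?IHs ?stratum2_square_low ?stratum1_square_low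
    ?stratum0_pos; pow_field.
have [_ _ count3] := span_count_F2_3 (s + k).
rewrite stratum_square // addSn /= count3.
have small : k = 1%N \/ k = 2%N \/ k = 3%N by lia.
by case: small => [-> | [] ->]; pow_field.
Qed.

Lemma stratum3_square_mid s j : (0 < s)%N -> (0 < j)%N -> (j <= s + 1)%N ->
  stratumQ 3 s (s + j) (s + j)
  = - (35 / 128) * pw s ^+ 2 * pw j ^+ 4 + 7 / 256 * pw s ^+ 2 * pw j ^+ 5
    + 45 / 32 * pw s ^+ 3 * pw j ^+ 3 - 7 / 4 * pw s ^+ 4 * pw j ^+ 2
    - 7 / 64 * pw s ^+ 4 * pw j ^+ 4 + 1 / 8 * pw s ^+ 6 * pw j ^+ 3.
Proof.
elim: s j => [|s IHs] j s_gt0 j_gt0 le_j; first by lia.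
case: (ltnP 3 (s.+1 + j)) => [gt3 | le3]; last first.
  have [_ _ count3] := span_count_F2_3 (s + (s.+1 + j)).
  rewrite stratum_square // addSn /= count3.
  have small : s = 0%N /\ (j = 1%N \/ j = 2%N) \/ s = 1%N /\ j = 1%N by lia.
  by case: small => [[-> [] ->] | [-> ->]]; pow_field.
rewrite stratum3S; try lia.
case: (ltnP 2 j) => [j_gt2 | j_le2].
  have -> : (s.+1 + j - 3 = s + (j - 2))%N by lia.
  by rewrite IHs ?stratum2_square_mid ?stratum_large; pow_field.
rewrite stratum3_square_low ?stratum2_square_low; try lia.
rewrite stratum1_square_low ?stratum0_pos; try lia.
have small : j = 1%N \/ j = 2%N by lia.
by case: small => ->; pow_field.
Qed.

Lemma natr_shift_factor j : ((2 ^ (4 * 3)) ^ j)%N%:R = pw j ^+ 12.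
Proof. by rewrite -expnM mulnC expnM !natrX. Qed.

Lemma stratum3_square_high s j : (j + 1 <= s)%N ->
  stratumQ 3 s (2 * s + 1 + j) (2 * s + 1 + j)
  = pw s ^+ 9 * pw j ^+ 3 - 7 / 4 * pw s ^+ 8 * pw j ^+ 4
    + 7 / 8 * pw s ^+ 7 * pw j ^+ 5 - 1 / 8 * pw s ^+ 6 * pw j ^+ 6.
Proof.
move=> lt_js; have [r def_s] : exists r, s = (r + j)%N by exists (s - j)%N; lia.
have -> : (2 * s + 1 + j = r + (r + 1) + 3 * j)%N by lia.
rewrite def_s stratum_shift; try lia.
rewrite card_Fp // natrM natr_shift_factor.
by rewrite stratum3_square_mid; pow_field.
Qed.

Lemma GammaE i s k : (0 < s)%N -> (0 < k)%N ->
  (Gamma i s s s k)%:R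
  = stratumQ 3 s k i + stratumQ 2 s k i + stratumQ 1 s k i + stratumQ 0 s k i.
Proof.
move=> s_gt0 k_gt0; rewrite Gamma_wrank // sum_stratum.
by rewrite !big_ord_recr big_ord0 /= !natrD; ring.
Qed.

Lemma Gamma_high i s k : (0 < s)%N -> (0 < k)%N -> (2 * s < i)%N ->
  Gamma i s s s k = stratum 'F_2 3 3 s k i.
Proof.
move=> s_gt0 k_gt0 lt_i; apply/eqP; rewrite -(eqr_nat rat) GammaE //.
rewrite (@stratum_large _ _ 2) ?(@stratum_large _ _ 1) ?stratum0_pos; try lia.
by rewrite !addr0.
Qed.

Lemma Gamma_shift i s k j : (0 < s)%N -> (0 < k)%N -> (2 * s < i)%N ->
  Gamma (i + 3 * j) (s + j) (s + j) (s + j) (k + 3 * j)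
  = (16 ^ (3 * j) * Gamma i s s s k)%N.
Proof.
move=> s_gt0 k_gt0 lt_i; rewrite !Gamma_high; try lia.
by rewrite stratum_shift // card_Fp // -[16%N]/(2 ^ 4)%N -!expnM mulnA.
Qed.

Lemma Gamma0 s k : (0 < s)%N -> Gamma 0 s s s k = 1%N.
Proof.
case: k => [|k] s_gt0; last first.
  apply/eqP; rewrite -(eqr_nat rat) GammaE // stratum0_0.
  by rewrite !(@stratum_small _ _ _.+1) // !add0r.
rewrite /Gamma -[RHS](cards1 (0 : 'M['F_2]_(s + (s + s), 0))).
apply: eq_card => M; have -> : M = 0 by apply/matrixP => i [].
rewrite !inE eqxx mxrank0 eqxx andbT.
by apply/and3P; split; apply/forallP => i; apply/forallP => -[].
Qed.

Lemma Gamma_low s i k : (0 < i)%N -> (i < s)%N -> (i < k)%N ->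
  (Gamma i s s s k)%:R = 105 / 64 * pw i ^+ 4 - 21 / 32 * pw i ^+ 3.
Proof.
move=> *.
rewrite GammaE ?stratum3_low ?stratum2_low ?stratum1_low ?stratum0_pos.
all: by [field | lia].
Qed.

Lemma Gamma_diagonal s k : (0 < s)%N -> (s < k)%N ->
  (Gamma s s s s k)%:R
  = 7 / 2 * pw s * pw k - 7 * pw s ^+ 2 + 105 / 64 * pw s ^+ 4
    - 21 / 32 * pw s ^+ 3.
Proof.
move=> *.
rewrite GammaE ?stratum3_low ?stratum2_low ?stratum1_top ?stratum0_pos.
all: by [field | lia].
Qed.

Lemma Gamma_mid s j k : (0 < j)%N -> (j < s)%N -> (s + j < k)%N ->
  (Gamma (s + j) s s s k)%:R
  = 735 / 128 * pw k * pw s * pw j ^+ 4 - 147 / 64 * pw k * pw s * pw j ^+ 3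
    + 105 / 64 * pw s ^+ 4 * pw j ^+ 4 - 21 / 32 * pw s ^+ 3 * pw j ^+ 3
    - 3255 / 256 * pw s ^+ 2 * pw j ^+ 5 + 735 / 128 * pw s ^+ 2 * pw j ^+ 4.
Proof.
move=> *; rewrite GammaE ?stratum3_mid ?stratum2_mid ?stratum_large.
all: by [field | lia].
Qed.

Lemma Gamma_double s k : (0 < s)%N -> (2 * s < k)%N ->
  (Gamma (2 * s) s s s k)%:R
  = 7 / 4 * pw k ^+ 2 * pw s ^+ 2 + 735 / 128 * pw k * pw s ^+ 5
    - 819 / 64 * pw k * pw s ^+ 4 + 105 / 64 * pw s ^+ 8
    - 3255 / 256 * pw s ^+ 7 + 2443 / 128 * pw s ^+ 6.
Proof.
move=> *; rewrite GammaE ?stratum3_double ?stratum2_top ?stratum_large.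
all: by [field | lia].
Qed.

Lemma Gamma_square_low s i : (0 < s)%N -> (0 < i)%N -> (i <= s + 1)%N ->
  (Gamma i s s s i)%:R
  = 1 / 8 * pw s ^+ 3 * pw i ^+ 3 - 7 / 64 * pw i ^+ 4 + 3 / 32 * pw i ^+ 3.
Proof.
move=> *; rewrite GammaE ?stratum3_square_low ?stratum2_square_low.
  rewrite ?stratum1_square_low ?stratum0_pos.
all: by [field | lia].
Qed.

Lemma Gamma_square_mid s j : (0 < s)%N -> (0 < j)%N -> (j <= s + 1)%N ->
  (Gamma (s + j) s s s (s + j))%:R
  = 1 / 8 * pw s ^+ 6 * pw j ^+ 3 + 7 / 256 * pw s ^+ 2 * pw j ^+ 5
    - 7 / 128 * pw s ^+ 2 * pw j ^+ 4 - 7 / 64 * pw s ^+ 4 * pw j ^+ 4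
    + 3 / 32 * pw s ^+ 3 * pw j ^+ 3.
Proof.
move=> *.
rewrite GammaE ?stratum3_square_mid ?stratum2_square_mid ?stratum_large.
all: by [field | lia].
Qed.

Lemma exprzM_natr (R : unitRingType) (x : R) (c m : nat) :
  x ^ (c%:R * m%:Z) = (x ^+ m) ^+ c.
Proof. by rewrite natz -PoszM -exprnP mulnC exprM. Qed.

Lemma exprzN_natr (R : unitRingType) (x : R) (c : nat) : x ^ (- c%:R) = x ^- c.
Proof. by rewrite natz -exprnN. Qed.

Ltac exprz_field :=
  rewrite ?(expfzDr _ _ (isT : (2 : rat) != 0)) ?exprzM_natr ?exprzN_natr;
  rewrite ?exprN1 -?exprnP; field; exact: isT.

Theorem theorem3p2 (s : nat) (hs : (1 <= s)%N) :
  (* rank i, arbitrary width k *)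
  ((forall k : nat, (Gamma 0 s s s k)%:R = 1 :> rat) /\
   (forall i k : nat, (1 <= i)%N -> (i + 1 <= s)%N -> (i + 1 <= k)%N ->
      (Gamma i s s s k)%:R
      = 105 * 2 ^ (4 * i%:Z - 6) - 21 * 2 ^ (3 * i%:Z - 5) :> rat) /\
   (forall k : nat, (s + 1 <= k)%N ->
      (Gamma s s s s k)%:R
      = 7 * 2 ^ (k%:Z + s%:Z - 1) - 7 * 2 ^ (2 * s%:Z)
        + 105 * 2 ^ (4 * s%:Z - 6) - 21 * 2 ^ (3 * s%:Z - 5) :> rat) /\
   (forall j k : nat, (1 <= j)%N -> (j + 1 <= s)%N -> (s + j + 1 <= k)%N ->
      (Gamma (s + j) s s s k)%:R
      = 147 * (5 * 2 ^ (j%:Z - 1) - 1) * 2 ^ (k%:Z + s%:Z + 3 * j%:Z - 6)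
        + 21 * (5 * 2 ^ (4 * s%:Z + 4 * j%:Z - 6)
                - 2 ^ (3 * s%:Z + 3 * j%:Z - 5)
                - (155 * 2 ^ (j%:Z - 1) - 35)
                  * 2 ^ (2 * s%:Z + 4 * j%:Z - 7)) :> rat) /\
   (forall k : nat, (2 * s + 1 <= k)%N ->
      (Gamma (2 * s) s s s k)%:R
      = 7 * 2 ^ (2 * k%:Z + 2 * s%:Z - 2)
        + 21 * (35 * 2 ^ (k%:Z + 5 * s%:Z - 7)
                - 39 * 2 ^ (k%:Z + 4 * s%:Z - 6))
        + 7 * (15 * 2 ^ (8 * s%:Z - 6) - 465 * 2 ^ (7 * s%:Z - 8)
               + 349 * 2 ^ (6 * s%:Z - 7)) :> rat) /\
   (forall j k : nat, (j + 2 <= s)%N -> (2 * s + 2 + j <= k)%N ->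
      (Gamma (2 * s + 1 + j) s s s k)%:R
      = 105 * (2 ^ (2 * k%:Z + 2 * s%:Z + 4 * j%:Z - 2)
               + 7 * 2 ^ (k%:Z + 5 * s%:Z + 4 * j%:Z - 3)
               - 31 * 2 ^ (k%:Z + 4 * s%:Z + 5 * j%:Z - 3))
        + 105 * (2 ^ (8 * s%:Z + 4 * j%:Z - 2)
                 - 31 * 2 ^ (7 * s%:Z + 5 * j%:Z - 3)
                 + 93 * 2 ^ (6 * s%:Z + 6 * j%:Z - 3)) :> rat) /\
   (forall k : nat, (3 * s <= k)%N ->
      (Gamma (3 * s) s s s k)%:R
      = 2 ^ (3 * k%:Z + 3 * s%:Z - 3) - 7 * 2 ^ (2 * k%:Z + 6 * s%:Z - 6)
        + 7 * 2 ^ (k%:Z + 9 * s%:Z - 8) - 2 ^ (12 * s%:Z - 9) :> rat)) /\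
  (* rank i, width i *)
  ((forall i : nat, (1 <= i)%N -> (i <= s + 1)%N ->
      (Gamma i s s s i)%:R
      = 2 ^ (3 * s%:Z + 3 * i%:Z - 3) - 7 * 2 ^ (4 * i%:Z - 6)
        + 3 * 2 ^ (3 * i%:Z - 5) :> rat) /\
   (forall j : nat, (1 <= j)%N -> (j <= s + 1)%N ->
      (Gamma (s + j) s s s (s + j))%:R
      = 2 ^ (6 * s%:Z + 3 * j%:Z - 3) + 7 * 2 ^ (2 * s%:Z + 5 * j%:Z - 8)
        - 7 * 2 ^ (2 * s%:Z + 4 * j%:Z - 7)
        - 7 * 2 ^ (4 * s%:Z + 4 * j%:Z - 6)
        + 3 * 2 ^ (3 * s%:Z + 3 * j%:Z - 5) :> rat) /\
   (forall j : nat, (j + 1 <= s)%N ->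
      (Gamma (2 * s + 1 + j) s s s (2 * s + 1 + j))%:R
      = 2 ^ (9 * s%:Z + 3 * j%:Z) - 7 * 2 ^ (8 * s%:Z + 4 * j%:Z - 2)
        + 7 * 2 ^ (7 * s%:Z + 5 * j%:Z - 3)
        - 2 ^ (6 * s%:Z + 6 * j%:Z - 3) :> rat)) /\
  (* reductions *)
  ((forall j k : nat, (j + 2 <= s)%N -> (2 * s + 2 + j <= k)%N ->
      Gamma (2 * s + 1 + j) s s s k
      = (16 ^ (3 * j)
         * Gamma (2 * (s - j) + 1) (s - j) (s - j) (s - j) (k - 3 * j))%N) /\
   (forall j : nat, (j + 1 <= s)%N ->
      Gamma (2 * s + 1 + j) s s s (2 * s + 1 + j)
      = (16 ^ (3 * j)
         * Gamma (2 * (s - j) + 1) (s - j) (s - j) (s - j)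
             (2 * (s - j) + 1))%N) /\
   (forall k : nat, (3 * s <= k)%N ->
      Gamma (3 * s) s s s k
      = (16 ^ (3 * (s - 1)) * Gamma 3 1 1 1 (k - 3 * (s - 1)))%N)).
Proof.
split; [|split].
- split; first by move=> k; rewrite Gamma0.
  split; first by move=> i k *; rewrite Gamma_low; [exprz_field | lia..].
  split; first by move=> k *; rewrite Gamma_diagonal; [exprz_field | lia..].
  split; first by move=> j k *; rewrite Gamma_mid; [exprz_field | lia..].
  split; first by move=> k *; rewrite Gamma_double; [exprz_field | lia..].
  split=> [j k * | k *].
    by rewrite Gamma_high ?stratum3_high; [exprz_field | lia..].
  by rewrite Gamma_high ?stratum3_top; [exprz_field | lia..].
- split; first by move=> i *; rewrite Gamma_square_low; [exprz_field | lia..].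
  split; first by move=> j *; rewrite Gamma_square_mid; [exprz_field | lia..].
  move=> j *; rewrite Gamma_high ?stratum3_square_high; try lia.
  by exprz_field.
- split=> [j k * | ]; first by rewrite -Gamma_shift; [congr Gamma | ..]; lia.
  split=> [j * | k *]; first by rewrite -Gamma_shift; [congr Gamma | ..]; lia.
  by rewrite -Gamma_shift; [congr Gamma | ..]; lia.
Qed.
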